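(* Let $s\ge1$ and, for each $j\in[s]$, let $x^j_1,\dots,x^j_n\in\mathbb{R}^{D_j}$ be vectors with $\|x^j_i\|_2\le1$, and let $\mathcal{K}^j\subseteq\mathbb{R}^{D_j}$ be a convex body whose standard Gaussian measure is at least $1-\delta_j$. If $\sum_{j=1}^s\delta_j<1/2$, then there exist signs $\sigma_1,\dots,\sigma_n\in\{-1,1\}$ such that \[ \sum_{i=1}^n\sigma_i x^j_i\in 5\sqrt{s}\,\mathcal{K}^j\quad\text{for all } j\in[s]. \] *)

(* Defs.v *)
From HB Require Import structures.
From mathcomp Require Import all_boot all_order all_algebra.
From mathcomp Require Import all_classical all_reals all_analysis.
Set Implicit Arguments. Unset Strict Implicit. Unset Printing Implicit Defensive.
Import Order.TTheory GRing.Theory Num.Theory.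
Import numFieldNormedType.Exports.
Local Open Scope classical_set_scope.
Local Open Scope ring_scope.

Definition l2norm {R : realType} {D : nat} (x : 'rV[R]_D) : R :=
  Num.sqrt (\sum_(i < D) x ord0 i ^+ 2).

Definition convex_rV {R : realType} {D : nat} (K : set 'rV[R]_D) : Prop :=
  forall x y (t : R), K x -> K y -> 0 <= t -> t <= 1 -> K (t *: x + (1 - t) *: y).

Definition convex_body {R : realType} {D : nat} (K : set 'rV[R]_D) : Prop :=
  convex_rV K /\ compact K /\ (K^°) !=set0.

(* Iterated integral against the standard one-dimensional Gaussian density
   (normal_pdf 0 1) in each of D coordinates; coordinates are given as a
   function nat -> R (only the first D are used). *)
Fixpoint gauss_iter {R : realType} (D : nat) (f : (nat -> R) -> \bar R) : \bar R :=
  match D with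
  | 0 => f (fun _ => 0)
  | D'.+1 => (\int[@lebesgue_measure R]_(t in [set: R])
                ((normal_pdf 0 1 t)%:E *
                 gauss_iter D' (fun y => f (fun k => if k is k'.+1 then y k' else t))))%E
  end.

(* Standard Gaussian measure of K subset of R^D (via Tonelli, the D-fold
   product of standard normal laws). *)
Definition gauss_measure {R : realType} (D : nat) (K : set 'rV[R]_D) : \bar R :=
  gauss_iter D (fun y => (\1_K (\row_(i < D) y (nat_of_ord i)) : R)%:E).

Definition dilate {R : realType} {D : nat} (c : R) (K : set 'rV[R]_D) : set 'rV[R]_D :=
  [set c *: k | k in K].

(* Main.v *)
(** The theorem follows from Banaszczyk's theorem with constant 5 for the product body: the
   concatenations of the x_i^j / (5 sqrt s) over j have norm at most 1/5, and the product of
   the K^j has Gaussian measure at least 1 - sum_j delta_j > 1/2.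

   Banaszczyk's theorem is proved one vector at a time. For a convex compact K let K*u be the
   union of the segments [w - u, w + 3u] over the w such that w and w + 2u lie in K. Then K*u
   is convex and compact, and each z in K*u has z - u or z + u in K. The main point is that
   gamma(K*u) >= gamma(K) as soon as gamma(K) >= 1/2 and |u| <= 1/5; when no vector is left,
   gamma(K) > 1/2 forces K to meet -K, so that 0 is in K.

   For the main point, rotate u onto the first axis, with h = |u|, and let L_k be the measure
   of the union of the chords of K in that direction of length at least 2hk/5. Passing to K*u
   loses the chords of length < 2h (k < 5) and multiplies the Gaussian measure of a longer
   chord by an explicit factor > 1. The midpoint Prekopa-Leindler inequality makes (L_k)
   log-concave. A chord has Gaussian measure at most its length over sqrt (2 pi), so the total
   mass 1 available to the chords bounds a weighted sum of the drops L_k - L_(k+1). These facts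
   and L_0 >= 1/2 imply that the gain exceeds the loss. *)
Require Import Defs.
From HB Require Import structures.
From mathcomp Require Import all_boot all_order all_algebra.
From mathcomp Require Import all_classical all_reals all_analysis.
From mathcomp Require Import measurable_realfun normal_distribution.
From mathcomp Require Import ring lra.
Set Implicit Arguments. Unset Strict Implicit. Unset Printing Implicit Defensive.
Import Order.TTheory GRing.Theory Num.Theory.
Import numFieldNormedType.Exports.
Local Open Scope classical_set_scope.
Local Open Scope ring_scope.

(** The union of K - u and K + u would be the natural successor of K, but it is not convex in
    general. On a chord [a, b] of length at least 2h, parallel to u, it is the interval
    [a - h, b + h]; keeping these chords only gives K*u, and convexity is paid for with the mass L_0
    - L_5 of the shorter ones. This loss is compared with the gain through the ratio of L_6 to L_5.
    If it is close to 1, log-concavity keeps L_0 close to L_5, and many chords are long but not too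
    long, where lengthening them pays. If it is smaller, L_k decays geometrically beyond k = 5, most
    chords are short and therefore light, and a mass of 1/2 leaves no room for a large loss. The
    length unit 2h/5 and the 40 classes of lengths are a discretization fine enough for the constant
    5. The Gaussian law on R^n is a nested product of normal laws, so every fact about it is an
    induction on coordinates that starts on the line. In particular u is moved to the axis by plane
    rotations, each of them a product of three shears, and a shear is a translation in each
    fibre. *)

(** * Lebesgue measure on the line: invariance, level sets, Brunn-Minkowski *)

Section lebesgue_line.
Context {R : realType}.
Local Notation mu := (@lebesgue_measure R).
Local Notation RT := (measurableTypeR R).

Lemma measurable_affine (a b : R) : measurable_fun setT (fun x : RT => a * x + b : RT).
Proof. by apply: measurable_funD => //; apply: measurable_funM. Qed.

Lemma lebesgue_measure_translate (c : R) (A : set R) : measurable A ->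
  mu [set x | A (x + c)] = mu A.
Proof.
move=> mA.
have mf : measurable_fun setT (fun x : RT => x + c : RT).
  by apply: measurable_funD.
rewrite -[LHS]/(pushforward mu (fun x : RT => x + c : RT) A).
apply/esym/lebesgue_measure_unique => //= _ [[a b]] _ <-.
rewrite /pushforward.
rewrite [X in _ = mu X](_ : _ = `]a - c, b - c]%classic); last first.
  by apply/seteqP; split => x /=; rewrite !in_itv /= => /andP[? ?]; apply/andP; split; lra.
rewrite !lebesgue_measure_itv/= !lte_fin.
rewrite ltrD2r; case: ifP => // _; congr (_%:E); lra.
Qed.

Lemma lebesgue_measure_half (A : set R) : measurable A ->
  mu [set x | A (x / 2)] = (2%:E * mu A)%E.
Proof.
move=> mA.
have mf : measurable_fun setT (fun x : RT => x / 2 : RT).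
  exact: measurable_funM.
have h0 : (0 <= 2^-1 :> R) by lra.
pose nu : {measure set RT -> \bar R} := mscale (NngNum h0) (pushforward mu (fun x : RT => x / 2 : RT)).
have -> : mu A = nu mf A.
  apply: lebesgue_measure_unique => //= _ [[a b]] _ <-.
  rewrite /nu /mscale /= /pushforward.
  rewrite [X in (_ * mu X)%E](_ : _ = `](a * 2), (b * 2)]%classic); last first.
    have E (x : R) : (a < x / 2 <= b) = (a * 2 < x <= b * 2).
      by rewrite ltr_pdivlMr// ler_pdivrMr.
    by apply/seteqP; split => x /=; rewrite !in_itv /= => h; [exact: (etrans (esym (E x)) h)|exact: (etrans (E x) h)].
  rewrite !lebesgue_measure_itv/= !lte_fin.
  rewrite ltr_pM2r//; case: ifP => _; last by rewrite mule0.
  by rewrite -!EFinD -EFinM; congr (_%:E); lra.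
rewrite /nu /mscale /= /pushforward muleA -EFinM divff// mul1e//.
Qed.

Lemma ge0_integral_translate (c : R) (f : R -> \bar R) :
  measurable_fun setT f -> (forall x, 0 <= f x)%E ->
  (\int[mu]_x f ((x : R) + c)%R = \int[mu]_x f x)%E.
Proof.
move=> mf f0.
have ms : measurable_fun setT (fun x : RT => x + c : RT).
  by apply: measurable_funD.
have := @ge0_integral_pushforward _ _ RT RT R _ ms mu setT f measurableT mf.
rewrite /= => <-; last by move=> ? _; exact: f0.
by apply: eq_measure_integral => A mA _; rewrite -[RHS](lebesgue_measure_translate c mA).
Qed.


Lemma measurable_lt_set d (T : measurableType d) (f g : T -> R) :
  measurable_fun setT f -> measurable_fun setT g -> measurable [set x | f x < g x].
Proof.
move=> mf mg; have := measurable_fun_ltr mf mg => /(_ measurableT [set true]).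
by rewrite setTI; exact.
Qed.

Lemma measurable_le_set d (T : measurableType d) (f g : T -> R) :
  measurable_fun setT f -> measurable_fun setT g -> measurable [set x | f x <= g x].
Proof.
move=> mf mg; have := measurable_fun_ler mf mg => /(_ measurableT [set true]).
by rewrite setTI; exact.
Qed.

Lemma measurable_subgraph d (T : measurableType d) (f : T -> R) : measurable_fun setT f ->
  measurable [set z : RT * T | 0 <= (z.1 : R) < f z.2].
Proof.
move=> mf.
rewrite [X in measurable X](_ : _ = [set z | 0 <= (z.1 : R)] `&` [set z | (z.1 : R) < f z.2]); last first.
  by apply/seteqP; split => z; [move=> /andP[]|move=> [h1 h2]; apply/andP; split].
apply: measurableI.
  apply: (@measurable_le_set _ (RT * T)%type (fun=> 0) (fun z => z.1)).
  exact: measurable_cst.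
  exact: measurable_fst.
apply: (@measurable_lt_set _ (RT * T)%type (fun z => z.1) (fun z => f z.2)) => //.
  exact: measurable_fst.
by apply: measurableT_comp => //; exact: measurable_snd.
Qed.

Lemma measure_ysection_subgraph (T : Type) (f : T -> R) (y : T) : 0 <= f y ->
  mu (ysection [set z : RT * T | 0 <= (z.1 : R) < f z.2] y) = (f y)%:E.
Proof.
move=> fy0; rewrite (_ : ysection _ y = `[0, f y[%classic); last first.
  apply/seteqP; split => v; first by move=> /ysectionP h; rewrite /= in_itv.
  by rewrite /= in_itv => h; apply/ysectionP.
rewrite lebesgue_measure_itv/= lte_fin; case: ltP => [_|fy0']; first by rewrite oppr0 adde0.
by congr (_%:E); apply/eqP; rewrite eq_le fy0 fy0'.
Qed.

(** Tonelli applied to the region under the graph. The level [v] runs over all of R, so the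
    condition [0 <= v] is part of the level set and negative levels contribute nothing. *)
Lemma layer_cake d (T : measurableType d) (m : {sigma_finite_measure set T -> \bar R})
    (f : T -> R) : measurable_fun setT f -> (forall x, 0 <= f x) ->
  (\int[m]_x (f x)%:E = \int[mu]_v m [set x | (0 <= (v : R) < f x)%R])%E.
Proof.
move=> mf f0.
pose A : set (RT * T) := [set z | 0 <= (z.1 : R) < f z.2].
have mA : measurable A by exact: measurable_subgraph.
have := @indic_fubini_tonelli _ _ RT T R mu m A mA.
rewrite indic_fubini_tonelli_FE// indic_fubini_tonelli_GE//= => E.
transitivity (\int[m]_x mu (ysection A x))%E.
  by apply: eq_integral => y _; rewrite measure_ysection_subgraph.
rewrite -E; apply: eq_integral => v _; congr (m _).
by apply/seteqP; split => x; [move=> /xsectionP|move=> h; apply/xsectionP].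
Qed.

(* The translates of A by min B and of B by max A both lie in C and meet only at max A + min B. *)
Lemma brunn_minkowski_compact (A B C : set R) : compact A -> compact B -> measurable C ->
  A !=set0 -> B !=set0 -> (forall x y, A x -> B y -> C (x + y)) ->
  (mu A + mu B <= mu C)%E.
Proof.
move=> cA cB mC A0 B0 ABC.
have ci (S : set R) : {within S, continuous (@idfun R)}.
  by apply: continuous_subspaceT => x; exact: cvg_id.
have [a /set_mem Aa amax] := compact_EVT_max A0 cA (ci A).
have [b /set_mem Bb bmin] := compact_EVT_min B0 cB (ci B).
have mA := compact_measurable cA; have mB := compact_measurable cB.
have mt (S : set R) c : measurable S -> measurable [set x : R | S (x + c)].
  move=> mS; rewrite -[X in measurable X]setTI.
  by apply: (@measurable_funD _ RT R setT id (cst c)).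
pose X := [set x : R | A (x - b)]; pose Y := [set x : R | B (x - a)].
have mX : measurable X by exact: mt.
have mY : measurable Y by exact: mt.
have <- : mu X = mu A by exact: lebesgue_measure_translate.
have <- : mu Y = mu B by exact: lebesgue_measure_translate.
have mY' : measurable (Y `\ (a + b)) by exact: measurableD.
have -> : mu Y = mu (Y `\ (a + b)).
  rewrite -[in RHS](@measureU0 _ _ _ mu _ [set (a + b)])//; last exact: lebesgue_measure_set1.
  rewrite setDKU// => _ ->; rewrite /Y /=.
  by have -> : a + b - a = b by ring.
rewrite -measureU//; last first.
  apply/seteqP; split => // x [Xx [Yx]] /=; apply.
  have := amax _ (mem_set Xx); have := bmin _ (mem_set Yx) => /=; lra.
apply: le_measure; rewrite ?inE//; first exact: measurableU.
move=> x [Xx|[Yx _]].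
  by have := ABC _ _ Xx Bb; rewrite subrK.
by have := ABC _ _ Aa Yx; rewrite addrC subrK.
Qed.

Lemma brunn_minkowski_line (A B C : set R) : measurable A -> measurable B -> measurable C ->
  A !=set0 -> B !=set0 -> (forall x y, A x -> B y -> C (x + y)) ->
  (mu A + mu B <= mu C)%E.
Proof.
move=> mA mB mC [a Aa] [b Bb] ABC.
have [Coo|] := leP +oo%E (mu C); first by rewrite (le_trans _ Coo) ?leey.
move=> Cfin.
have Cf : mu C \is a fin_num by rewrite ge0_fin_numE.
(* Inner regularity with one set varying at a time, used for A and then for B. Adjoining [s] to a
   compact subset keeps it nonempty; the singleton of [s] already shows that [m] is finite, which
   the subtraction from [mu C] requires. *)
have step (S : set R) s m : measurable S -> S s -> (0 <= m)%E ->
    (forall K, compact K -> K `<=` S -> K s -> (mu K + m <= mu C)%E) ->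
    (mu S + m <= mu C)%E.
  move=> mS Ss m0 H.
  have mfin : m \is a fin_num.
    rewrite ge0_fin_numE// (le_lt_trans _ Cfin)//.
    have := H [set s]; rewrite lebesgue_measure_set1 add0e; apply => //.
    - exact: compact_set1.
    - by move=> _ ->.
  rewrite -leeBrDr// lebesgue_regularity_inner_sup//.
  apply: ge_ereal_sup => /= _ [K [cK KS] <-].
  rewrite leeBrDr//; apply: le_trans (H (K `|` [set s]) _ _ _); last by right.
  - have mK := compact_measurable cK.
    have mKs : measurable (K `|` [set s]) by exact: measurableU.
    by apply: leeD2r; apply: le_measure; rewrite ?inE//; exact: subsetUl.
  - by apply: compactU => //; exact: compact_set1.
  - by move=> x [/KS//|->].
apply: (step _ a) => // K cK KA Ka.
rewrite addeC; apply: (step _ b) => // L cL LB Lb.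
rewrite addeC; apply: brunn_minkowski_compact => //; [by exists a|by exists b|].
by move=> x y /KA ? /LB ?; exact: ABC.
Qed.

End lebesgue_line.

(** * The midpoint Prekopa-Leindler inequality on the line *)

Section prekopa_leindler_line.
Context {R : realType}.
Local Notation mu := (@lebesgue_measure R).
Local Notation RT := (measurableTypeR R).

Lemma measurable_tail d (T : measurableType d) (m : {sigma_finite_measure set T -> \bar R})
    (f : T -> R) : measurable_fun setT f ->
  measurable_fun setT (fun v : RT => m [set x | (0 <= (v : R) < f x)%R]).
Proof.
move=> mf.
have := measurable_fun_xsection m (measurable_subgraph mf).
congr (measurable_fun _ _); apply/funext => v /=; congr (m _).
by apply/seteqP; split => x; [move=> /xsectionP|move=> h; apply/xsectionP].
Qed.

Let lvl (f : R -> R) (v : R) := [set x | 0 <= v < f x].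

Let mlvl f v : measurable_fun setT f -> measurable (lvl f v).
Proof.
move=> mf; rewrite (_ : lvl f v = [set x | 0 <= v] `&` [set x | v < f x]); last first.
  by apply/seteqP; split => z; [move=> /andP[]|move=> [h1 h2]; apply/andP; split].
by apply: measurableI; [exact: measurable_le_set|exact: measurable_lt_set].
Qed.

Let layer (f : R -> R) : measurable_fun setT f -> (forall x, 0 <= f x) ->
  (\int[mu]_x (f x)%:E = \int[mu]_v mu (lvl f v))%E.
Proof. by move=> mf f0; exact: layer_cake. Qed.

Let mtail (f : R -> R) : measurable_fun setT f -> measurable_fun setT (fun v : RT => mu (lvl f v)).
Proof. exact: (@measurable_tail _ RT mu f). Qed.

(* Both functions have supremum 1, so for v < 1 their level sets are nonempty and the level set
   of h contains their midpoints: integrate Brunn-Minkowski over v. *)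
Lemma prekopa_leindler_sup1 (f g h : R -> R) :
  measurable_fun setT f -> measurable_fun setT g -> measurable_fun setT h ->
  (forall x, 0 <= f x) -> (forall x, 0 <= g x) -> (forall x, 0 <= h x) ->
  sup (range f) = 1 -> sup (range g) = 1 -> has_ubound (range f) -> has_ubound (range g) ->
  (forall x y, f x * g y <= h ((x + y) / 2) ^+ 2) ->
  (\int[mu]_x (f x)%:E + \int[mu]_x (g x)%:E <= 2%:E * \int[mu]_x (h x)%:E)%E.
Proof.
move=> mf mg mh f0 g0 h0 sf sg uf ug fgh.
rewrite !layer// -ge0_integralD//; try exact: mtail.
rewrite -ge0_integralZl//; last exact: mtail.
apply: ge0_le_integral => //.
- by move=> v _; exact: adde_ge0.
- by apply: emeasurable_funD; exact: mtail.
- by apply: measurable_funeM; exact: mtail.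
move=> v _.
have [v0|v0] := ltP (v : R) 0.
  have E (k : R -> R) : lvl k v = set0.
    by rewrite -subset0 => x /= /andP[]; rewrite leNgt v0.
  by rewrite !E measure0 adde0 mule0.
have [v1|v1] := ltP (v : R) 1; last first.
  have E (k : R -> R) : has_ubound (range k) -> sup (range k) = 1 ->
      lvl k v = set0.
    move=> uk sk; rewrite -subset0 => x /= /andP[_]; rewrite ltNge.
    by rewrite (le_trans _ v1)// -sk ub_le_sup//; exists x.
  by rewrite (E f)// (E g)// measure0 adde0 mule_ge0.
have nonempty (k : R -> R) : sup (range k) = 1 -> has_ubound (range k) ->
    lvl k v !=set0.
  move=> sk uk; have [||_ [x _ <-] vx] := @sup_adherent _ (range k) (1 - v).
  - by rewrite subr_gt0.
  - by split => //; exists (k 0), 0.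
  - exists x; apply/andP; split => //; move: vx; rewrite sk opprB addrC subrK; exact.
rewrite -lebesgue_measure_half; last exact: mlvl.
apply: brunn_minkowski_line; [exact: mlvl|exact: mlvl| |exact: nonempty|exact: nonempty|].
  have := @measurable_affine R 2^-1 0 measurableT _ (mlvl v mh).
  rewrite setTI; congr measurable; apply/seteqP.
  by split=> x /=; rewrite addr0 mulrC.
move=> x y /andP[_ vx] /andP[_ vy]; apply/andP; split => //.
have v2 : (v : R) ^+ 2 < h ((x + y) / 2) ^+ 2.
  by rewrite (lt_le_trans _ (fgh x y))// expr2 ltr_pM.
by move: v2; rewrite ltr_pXn2r ?nnegrE.
Qed.

(** Dividing f and g by their suprema a and b, and h by sqrt (a b), preserves the pointwise
    inequality and makes both suprema 1. The additive conclusion p + q <= 2r for the rescaled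
    integrals gives pq <= r^2 by the arithmetic-geometric mean inequality. The bound [M] keeps the
    suprema finite; squares on the right avoid roots. *)
Lemma prekopa_leindler_line (f g h : R -> R) (M : R) :
  measurable_fun setT f -> measurable_fun setT g -> measurable_fun setT h ->
  (forall x, 0 <= f x <= M) -> (forall x, 0 <= g x <= M) -> (forall x, 0 <= h x) ->
  (\int[mu]_x (f x)%:E < +oo)%E -> (\int[mu]_x (g x)%:E < +oo)%E ->
  (\int[mu]_x (h x)%:E < +oo)%E ->
  (forall x y, f x * g y <= h ((x + y) / 2) ^+ 2) ->
  Rintegral mu setT f * Rintegral mu setT g <= Rintegral mu setT h ^+ 2.
Proof.
move=> mf mg mh fM gM h0 ffin gfin hfin fgh.
have f0 x : 0 <= f x by case/andP: (fM x).
have g0 x : 0 <= g x by case/andP: (gM x).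
have ubf : has_ubound (range f) by exists M => _ [x _ <-]; case/andP: (fM x).
have ubg : has_ubound (range g) by exists M => _ [x _ <-]; case/andP: (gM x).
have sup_ge (k : R -> R) : has_ubound (range k) -> forall x, k x <= sup (range k).
  by move=> uk x; apply: ub_le_sup => //; exists x.
have deg (k : R -> R) : (forall x, 0 <= k x) -> (forall x, k x <= 0) -> Rintegral mu setT k = 0.
  move=> k0 k0'; rewrite /Rintegral integral0_eq// => x _.
  by congr (_%:E); apply/eqP; rewrite eq_le k0 k0'.
have sq0 : 0 <= Rintegral mu setT h ^+ 2 by exact: sqr_ge0.
set a := sup (range f); set b := sup (range g).
(* A nonnegative function with nonpositive supremum vanishes, and so does its integral; the
   rescaling below divides by a and b. *)
have [a0|a0] := leP a 0.
  by rewrite (deg f) ?mul0r// => x; apply: le_trans a0; exact: sup_ge.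
have [b0|b0] := leP b 0.
  by rewrite (deg g) ?mulr0// => x; apply: le_trans b0; exact: sup_ge.
pose c := Num.sqrt (a * b).
have c0 : 0 < c by rewrite sqrtr_gt0 mulr_gt0.
have cE : c ^+ 2 = a * b by rewrite sqr_sqrtr// mulr_ge0// ltW.
have scale (k : R -> R) (t : R) : measurable_fun setT k -> (forall x, 0 <= k x) -> 0 < t ->
    (\int[mu]_x (k x)%:E < +oo)%E ->
    (\int[mu]_x (k x / t)%:E = (Rintegral mu setT k / t)%:E)%E.
  move=> mk k0 t0 kfin.
  under eq_integral do rewrite mulrC EFinM.
  rewrite ge0_integralZl_EFin ?invr_ge0 ?(ltW t0)//; last exact/measurable_EFinP.
    rewrite mulrC EFinM /Rintegral fineK// ge0_fin_numE//.
    by apply: integral_ge0 => x _; rewrite lee_fin.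
  by move=> x _; rewrite lee_fin.
have sup1 (k : R -> R) : has_ubound (range k) -> (forall x, 0 <= k x) ->
    0 < sup (range k) -> sup (range (fun x => k x / sup (range k))) = 1
      /\ has_ubound (range (fun x => k x / sup (range k))).
  move=> uk k0 s0.
  have ub1 : ubound (range (fun x => k x / sup (range k))) 1.
    by move=> _ [x _ <-]; rewrite ler_pdivrMr// mul1r sup_ge.
  split; last by exists 1.
  apply/eqP; rewrite eq_le; apply/andP; split.
    by apply: ge_sup => //; exists (k 0 / sup (range k)), 0.
  rewrite leNgt; apply/negP => s1.
  set s' := sup _ in s1.
  have : sup (range k) <= s' * sup (range k).
    apply: ge_sup; first by exists (k 0), 0.
    move=> _ [x _ <-]; rewrite -ler_pdivrMr//; apply: ub_le_sup; first by exists 1.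
    by exists x.
  by rewrite ler_pMl// leNgt s1.
have [sf1 uf1] := sup1 f ubf f0 a0.
have [sg1 ug1] := sup1 g ubg g0 b0.
have dv (k : R -> R) t : measurable_fun setT k -> measurable_fun setT (fun x => k x / t).
  by move=> mk; exact: measurable_funM.
have := @prekopa_leindler_sup1 (fun x => f x / a) (fun x => g x / b) (fun x => h x / c)
  (dv _ _ mf) (dv _ _ mg) (dv _ _ mh).
rewrite !scale// -EFinM -EFinD lee_fin => H.
have {H} : Rintegral mu setT f / a + Rintegral mu setT g / b <= 2 * (Rintegral mu setT h / c).
  apply: H => //; try by move=> x; rewrite divr_ge0// ltW.
  move=> x y; rewrite expr_div_n cE mulf_div ler_pM2r ?invr_gt0 ?mulr_gt0//.
have If0 : 0 <= Rintegral mu setT f by apply: Rintegral_ge0.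
have Ig0 : 0 <= Rintegral mu setT g by apply: Rintegral_ge0.
have Ih0 : 0 <= Rintegral mu setT h by apply: Rintegral_ge0.
move: If0 Ig0 Ih0; set F := Rintegral mu setT f; set G := Rintegral mu setT g; set H := Rintegral mu setT h.
move=> F0 G0 H0 FGH.
have -> : F * G = (F / a) * (G / b) * c ^+ 2 by rewrite cE; field; rewrite !gt_eqF.
have -> : H = (H / c) * c by rewrite divfK// gt_eqF.
rewrite exprMn ler_pM2r ?exprn_gt0//.
have Fa0 : 0 <= F / a by rewrite divr_ge0// ltW.
have Gb0 : 0 <= G / b by rewrite divr_ge0// ltW.
have Hc0 : 0 <= H / c by rewrite divr_ge0// ltW.
move: FGH Fa0 Gb0 Hc0; set p := F / a; set q := G / b; set r := H / c => pqr p0 q0 r0.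
have := sqr_ge0 (p - q).
have : 0 <= (2 * r - (p + q)) * (2 * r + (p + q)) by apply: mulr_ge0; lra.
nra.
Qed.

End prekopa_leindler_line.

(** * The standard normal law and its density *)

Section gauss_line.
Context {R : realType}.
Local Notation mu := (@lebesgue_measure R).
Local Notation RT := (measurableTypeR R).
Local Notation N := (@normal_prob R 0 1).
Local Notation phi := (@normal_pdf R 0 1).

Lemma std_normal_pdfE (x : R) : phi x = normal_peak 1 * expR (- (x ^+ 2 / 2)).
Proof.
rewrite normal_pdfE ?oner_eq0// /normal_fun subr0 expr1n.
by rewrite mulNr -[1 *+ 2]/(2%:R).
Qed.

(** The layer-cake formula replaces a change of measure: at each level the normal law of a set is an
    integral of [phi], and Tonelli then lets the levels be integrated first. *)
Lemma integral_std_normal (f : R -> R) : measurable_fun setT f -> (forall x, 0 <= f x) ->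
  (\int[N]_x (f x)%:E = \int[mu]_x (phi x * f x)%:E)%E.
Proof.
move=> mf f0.
have mphi : measurable_fun setT (fun x : RT => phi x) by exact: measurable_normal_pdf.
rewrite (@layer_cake _ _ RT N f)//.
pose A : set (RT * RT) := [set z | 0 <= (z.1 : R) < f z.2].
have mA : measurable A.
  exact: (@measurable_subgraph _ _ RT).
pose k (z : RT * RT) : \bar R := (phi z.2 * \1_A z)%:E.
have mk : measurable_fun setT k.
  apply/measurable_EFinP; apply: measurable_funM.
    by apply: measurableT_comp => //; exact: measurable_snd.
  exact: measurable_indic.
have k0 z : (0 <= k z)%E by rewrite lee_fin mulr_ge0// normal_pdf_ge0.
transitivity (\int[mu]_v \int[mu]_x k (v, x))%E.
  apply: eq_integral => v _.
  rewrite /normal_prob [LHS]integral_mkcond;  apply: eq_integral => x _.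
  rewrite patchE /k indicE /= (_ : (x \in _) = ((v, x) \in A)); last first.
    by apply/idP/idP; rewrite !inE.
  by case: ifP; rewrite ?mulr1 ?mulr0.
rewrite fubini_tonelli//; apply: eq_integral => x _.
have mA' : measurable (ysection A x) by exact: measurable_ysection.
transitivity (\int[mu]_v ((phi x)%:E * (\1_(ysection A x) v)%:E))%E.
  apply: eq_integral => v _; rewrite /k /= EFinM !indicE; congr (_ * (_ %:R)%:E)%E.
  by rewrite mem_ysection.
rewrite ge0_integralZl_EFin ?normal_pdf_ge0//; last first.
  by apply/measurable_EFinP; exact: measurable_indic.
rewrite EFinM integral_indic// setIT; congr (_ * _)%E.
exact: measure_ysection_subgraph.
Qed.

Lemma integral_std_normal_lty (f : R -> R) : measurable_fun setT f -> (forall x, 0 <= f x <= 1) ->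
  (\int[mu]_x (phi x * f x)%:E <= 1)%E.
Proof.
move=> mf f01; rewrite -(integral_normal_pdf (0 : R) (1 : R)).
apply: ge0_le_integral => //.
- by move=> x _; rewrite lee_fin mulr_ge0 ?normal_pdf_ge0//; case/andP: (f01 x).
- by apply/measurable_EFinP/measurable_funM => //; exact: measurable_normal_pdf.
- by apply/measurable_EFinP; exact: measurable_normal_pdf.
- by move=> x _; rewrite lee_fin ler_piMr ?normal_pdf_ge0//; case/andP: (f01 x).
Qed.

Lemma std_normal_pdf_midpoint (x y : R) : phi x * phi y <= phi ((x + y) / 2) ^+ 2.
Proof.
rewrite !std_normal_pdfE expr2 [leLHS]mulrACA [leRHS]mulrACA ler_pM2l ?mulr_gt0 ?normal_peak_gt0//.
rewrite -!expRD ler_expR.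
have := sqr_ge0 (x - y); nra.
Qed.

(** The density is itself midpoint log-concave, so it can be absorbed into each of the three
    functions. *)
Lemma prekopa_leindler_std_normal (f g h : R -> R) :
  measurable_fun setT f -> measurable_fun setT g -> measurable_fun setT h ->
  (forall x, 0 <= f x <= 1) -> (forall x, 0 <= g x <= 1) -> (forall x, 0 <= h x <= 1) ->
  (forall x y, f x * g y <= h ((x + y) / 2) ^+ 2) ->
  Rintegral N setT f * Rintegral N setT g <= Rintegral N setT h ^+ 2.
Proof.
move=> mf mg mh f01 g01 h01 fgh.
have ge0 (k : R -> R) : (forall x, 0 <= k x <= 1) -> forall x, 0 <= k x.
  by move=> k01 x; case/andP: (k01 x).
have RE (k : R -> R) : measurable_fun setT k -> (forall x, 0 <= k x <= 1) ->
    Rintegral N setT k = Rintegral mu setT (fun x => phi x * k x).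
  by move=> mk k01; rewrite /Rintegral integral_std_normal//; exact: ge0.
have mM (k : R -> R) : measurable_fun setT k -> measurable_fun setT (fun x => phi x * k x).
  by move=> mk; apply: measurable_funM => //; exact: measurable_normal_pdf.
have lty (k : R -> R) : measurable_fun setT k -> (forall x, 0 <= k x <= 1) ->
    (\int[mu]_x (phi x * k x)%:E < +oo)%E.
  by move=> mk k01; rewrite (le_lt_trans (integral_std_normal_lty mk k01))// ltry.
have bd (k : R -> R) : (forall x, 0 <= k x <= 1) ->
    forall x, 0 <= phi x * k x <= normal_peak 1.
  move=> k01 x; case/andP: (k01 x) => k0 k1; rewrite mulr_ge0 ?normal_pdf_ge0//=.
  by rewrite -[leRHS]mulr1 ler_pM ?normal_pdf_ge0// normal_pdf_ub ?oner_eq0.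
rewrite !RE//; apply: (@prekopa_leindler_line _ _ _ _ (normal_peak 1)).
- exact: mM.
- exact: mM.
- exact: mM.
- exact: bd.
- exact: bd.
- by move=> x; case/andP: (bd _ h01 x).
- exact: lty.
- exact: lty.
- exact: lty.
move=> x y; rewrite mulrACA exprMn ler_pM ?mulr_ge0 ?normal_pdf_ge0 ?ge0//.
exact: std_normal_pdf_midpoint.
Qed.

End gauss_line.

(** * Rotation invariance of the Gaussian law in the plane *)

Section plane_rotation.
Context {R : realType}.
Local Notation mu := (@lebesgue_measure R).
Local Notation RT := (measurableTypeR R).
Local Notation N := (@normal_prob R 0 1).
Local Notation phi := (@normal_pdf R 0 1).

(** In each fibre a shear is a translation, so Tonelli and translation invariance on the line
    suffice. *)
Lemma integral_shear_l (a : R) (k : RT * RT -> \bar R) :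
  measurable_fun setT k -> (forall z, 0 <= k z)%E ->
  (\int[mu]_x \int[mu]_y k (((x : R) + a * (y : R))%R, y) = \int[mu]_x \int[mu]_y k (x, y))%E.
Proof.
move=> mk k0.
have mk' : measurable_fun setT (fun z : RT * RT => k (((z.1 : R) + a * (z.2 : R))%R : RT, z.2)).
  apply: measurableT_comp => //; apply: measurable_fun_pair; last exact: measurable_snd.
  apply: (@measurable_funD _ (RT * RT)%type R); first exact: measurable_fst.
  by apply: (@measurable_funM _ (RT * RT)%type R) => //; exact: measurable_snd.
have e1 := @fubini_tonelli _ _ RT RT R mu mu _ mk' (fun z => k0 _).
refine (etrans e1 (etrans _ (esym (@fubini_tonelli _ _ RT RT R mu mu k mk k0)))).
apply: eq_integral => y _.
apply: (@ge0_integral_translate _ (a * (y : R)) (fun x => k (x, y))) => //.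
exact: (measurableT_comp mk (pair2_measurable y)).
Qed.

Lemma integral_shear_r (a : R) (k : RT * RT -> \bar R) :
  measurable_fun setT k -> (forall z, 0 <= k z)%E ->
  (\int[mu]_x \int[mu]_y k (x, ((y : R) + a * (x : R))%R) = \int[mu]_x \int[mu]_y k (x, y))%E.
Proof.
move=> mk k0; apply: eq_integral => x _.
apply: (@ge0_integral_translate _ (a * (x : R)) (fun y => k (x, y))) => //.
exact: (measurableT_comp mk (pair1_measurable x)).
Qed.

(** Factorization of a rotation into the shears with parameters - a, s and - a; for c = cos t and s
    = sin t, the number a is tan (t / 2). *)
Lemma rotation_by_shears (a c s x y : R) : a * s = 1 - c -> a * (1 + c) = s ->
  c * x - s * y = x + - a * y + - a * (s * x + c * y) /\
  s * x + c * y = y + s * (x + - a * y).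
Proof.
move=> as_ ac; split.
  have -> : x + - a * y + - a * (s * x + c * y) = (1 - a * s) * x - a * (1 + c) * y by ring.
  by rewrite as_ ac; ring.
have -> : y + s * (x + - a * y) = s * x + (1 - a * s) * y by ring.
by rewrite as_; ring.
Qed.

Lemma integral_rotation (c s : R) (k : RT * RT -> \bar R) : s != 0 -> c ^+ 2 + s ^+ 2 = 1 ->
  measurable_fun setT k -> (forall z, 0 <= k z)%E ->
  (\int[mu]_x \int[mu]_y k ((c * (x : R) - s * (y : R))%R, (s * (x : R) + c * (y : R))%R)
   = \int[mu]_x \int[mu]_y k (x, y))%E.
Proof.
move=> s0 cs mk k0; pose a := (1 - c) / s.
have mxy (u v : RT * RT -> RT) : measurable_fun setT u -> measurable_fun setT v ->
    measurable_fun setT (fun z => k (u z, v z)).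
  by move=> mu' mv; apply: measurableT_comp => //; exact: measurable_fun_pair.
pose k2 (z : RT * RT) := k (((z.1 : R) + (- a) * (z.2 : R))%R, z.2).
pose k1 (z : RT * RT) := k2 (z.1, ((z.2 : R) + s * (z.1 : R))%R).
have m1 := @measurable_fst _ _ RT RT; have m2 := @measurable_snd _ _ RT RT.
have lin b : measurable_fun setT (fun z : RT * RT => ((z.1 : R) + b * (z.2 : R) : R)).
  by apply: measurable_funD => //; exact: measurable_funM.
have lin' b : measurable_fun setT (fun z : RT * RT => ((z.2 : R) + b * (z.1 : R) : R)).
  by apply: measurable_funD => //; exact: measurable_funM.
have mk2 : measurable_fun setT k2 by apply: mxy => //; exact: lin.
have mk1 : measurable_fun setT k1.
  apply: (@measurableT_comp _ _ _ _ _ _ k2) => //.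
  by apply: measurable_fun_pair => //; exact: lin'.
have e1 := integral_shear_l (- a) mk k0.
have e2 := integral_shear_r s mk2 (fun z => k0 _).
have e3 := integral_shear_l (- a) mk1 (fun z => k0 _).
refine (etrans _ (etrans e3 (etrans e2 e1))).
apply: eq_integral => x _; apply: eq_integral => y _; rewrite /k1 /k2 /=.
have as_ : a * s = 1 - c by rewrite /a divfK.
have ac : a * (1 + c) = s.
  apply: (mulIf s0); have -> : a * (1 + c) * s = a * s * (1 + c) by ring.
  by rewrite as_ -expr2 (_ : s ^+ 2 = 1 - c ^+ 2); [ring|rewrite -cs; ring].
have [E1 E2] := rotation_by_shears x y as_ ac.
by congr (k (_, _)); rewrite ?E1 ?E2.
Qed.

Lemma integral2_std_normal (f : RT * RT -> R) : measurable_fun setT f ->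
  (forall z, 0 <= f z <= 1) ->
  (\int[N]_x \int[N]_y (f (x, y))%:E =
   \int[mu]_x \int[mu]_y (phi x * phi y * f (x, y))%:E)%E.
Proof.
move=> mf f01.
have f0 z : 0 <= f z by case/andP: (f01 z).
have mN : measurable_fun setT (fun z : RT * RT => (phi z.2 * f z)%:E).
  apply/measurable_EFinP; apply: measurable_funM => //.
  have mphi : measurable_fun setT (fun x : RT => phi x) by exact: measurable_normal_pdf.
  by apply: measurableT_comp => //; exact: measurable_snd.
have mfx x : measurable_fun setT (fun y : RT => f (x, y)).
  exact: (measurableT_comp mf (pair1_measurable x)).
have inner x : (\int[N]_y (f (x, y))%:E = \int[mu]_y (phi y * f (x, y))%:E)%E.
  apply: (@integral_std_normal _ (fun y => f (x, y))); first exact: mfx.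
  by move=> y; exact: f0.
pose G (x : R) : \bar R := (\int[mu]_y (phi y * f (x, y))%:E)%E.
have mG : measurable_fun setT (G : RT -> \bar R).
  apply: (@measurable_fun_fubini_tonelli_F _ _ RT RT R mu (fun z => (phi z.2 * f z)%:E)) => //.
  by move=> z; rewrite lee_fin mulr_ge0 ?normal_pdf_ge0.
have G0 x : (0 <= G x)%E.
  by apply: integral_ge0 => y _; rewrite lee_fin mulr_ge0 ?normal_pdf_ge0.
have Gfin x : G x \is a fin_num.
  have Gle : (G x <= 1)%E.
    by apply: (@integral_std_normal_lty _ (fun y => f (x, y))) => //; exact: mfx.
  by rewrite ge0_fin_numE// (le_lt_trans Gle)// ltry.
(* The inner integral is finite, being at most 1; [fine] turns it into a real function, to which the
   one-dimensional formula applies. *)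
transitivity (\int[N]_x (fine (G x))%:E)%E.
  by apply: eq_integral => x _; rewrite inner fineK.
rewrite (@integral_std_normal _ (fun x => fine (G x)))//; last 2 first.
- exact: measurableT_comp.
- by move=> x; rewrite fine_ge0.
apply: eq_integral => x _; rewrite EFinM fineK// -ge0_integralZl_EFin ?normal_pdf_ge0//.
- by apply: eq_integral => y _; rewrite -EFinM mulrA.
- by move=> y _; rewrite lee_fin mulr_ge0 ?normal_pdf_ge0.
- apply/measurable_EFinP; apply: measurable_funM => //; exact: measurable_normal_pdf.
Qed.

Lemma measurable_rotation (c s : R) : measurable_fun setT (fun z : RT * RT =>
  ((c * (z.1 : R) - s * (z.2 : R))%R : RT, (s * (z.1 : R) + c * (z.2 : R))%R : RT)).
Proof.
have m1 := @measurable_fst _ _ RT RT; have m2 := @measurable_snd _ _ RT RT.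
apply: measurable_fun_pair.
  by apply: (@measurable_funB _ _ R); exact: measurable_funM.
by apply: (@measurable_funD _ _ R); exact: measurable_funM.
Qed.

Lemma integral_std_normal_rotation (c s : R) (f : RT * RT -> R) : s != 0 ->
  c ^+ 2 + s ^+ 2 = 1 -> measurable_fun setT f -> (forall z, 0 <= f z <= 1) ->
  (\int[N]_x \int[N]_y (f ((c * (x : R) - s * (y : R))%R, (s * (x : R) + c * (y : R))%R))%:E
   = \int[N]_x \int[N]_y (f (x, y))%:E)%E.
Proof.
move=> s0 cs mf f01.
have m1 := @measurable_fst _ _ RT RT; have m2 := @measurable_snd _ _ RT RT.
pose fr (z : RT * RT) := f ((c * (z.1 : R) - s * (z.2 : R))%R, (s * (z.1 : R) + c * (z.2 : R))%R).
have mfr : measurable_fun setT fr by exact: (measurableT_comp mf (measurable_rotation c s)).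
refine (etrans (integral2_std_normal mfr (fun z => f01 _)) (etrans _ (esym (integral2_std_normal mf f01)))).
refine (etrans _ (@integral_rotation c s (fun z => (phi z.1 * phi z.2 * f z)%:E) s0 cs _ _)).
(* The joint density depends on x^2 + y^2 only, which the rotation preserves. *)
- apply: eq_integral => x _; apply: eq_integral => y _ /=; congr ((_ * _)%:E).
  rewrite !std_normal_pdfE mulrACA [RHS]mulrACA -!expRD; congr (_ * expR _).
  by rewrite -!opprD -!mulrDl; congr (- (_ / 2)); rewrite -[LHS]mul1r -cs; ring.
- apply/measurable_EFinP; apply: measurable_funM => //.
  have mphi : measurable_fun setT (fun x : RT => phi x) by exact: measurable_normal_pdf.
  by apply: measurable_funM; apply: measurableT_comp.
- by move=> z; rewrite lee_fin !mulr_ge0 ?normal_pdf_ge0//; case/andP: (f01 z).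
Qed.

End plane_rotation.

(** * Integrals of functions with values in [0, 1] over products of probabilities *)

Section product_Rintegral.
Context {R : realType} d1 d2 (T1 : measurableType d1) (T2 : measurableType d2).
Variables (P1 : probability T1 R) (P2 : probability T2 R).
Variable f : T1 * T2 -> R.
Hypotheses (mf : measurable_fun setT f) (f01 : forall z, 0 <= f z <= 1).

Let f0 z : 0 <= f z. Proof. by case/andP: (f01 z). Qed.
Let f1 z : f z <= 1. Proof. by case/andP: (f01 z). Qed.

Let int01 d (T : measurableType d) (P : probability T R) (k : T -> R) :
  measurable_fun setT k -> (forall x, 0 <= k x <= 1) ->
  (0 <= \int[P]_x (k x)%:E <= 1)%E.
Proof.
move=> mk k01; apply/andP; split.
  by apply: integral_ge0 => x _; rewrite lee_fin; case/andP: (k01 x).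
apply: (@le_trans _ _ (\int[P]_x (cst 1%E x))%E).
  apply: ge0_le_integral => //.
  - by move=> x _; rewrite lee_fin; case/andP: (k01 x).
  - exact/measurable_EFinP.
  - by move=> x _; rewrite lee_fin; case/andP: (k01 x).
by rewrite integral_cst// mul1e probability_le1.
Qed.

Lemma Rintegral01 d (T : measurableType d) (P : probability T R) (k : T -> R) :
  measurable_fun setT k -> (forall x, 0 <= k x <= 1) -> 0 <= Rintegral P setT k <= 1.
Proof.
move=> mk k01; have /andP[I0 I1] := int01 P mk k01.
have Ifin : (\int[P]_x (k x)%:E)%E \is a fin_num.
  by rewrite ge0_fin_numE// (le_lt_trans I1)// ltry.
by rewrite -!lee_fin /Rintegral fineK// I0 I1.
Qed.

(** Values in [0, 1] make every integral finite, so [fine] loses nothing. *)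
Lemma Rintegral01_fineK d (T : measurableType d) (P : probability T R) (k : T -> R) :
  measurable_fun setT k -> (forall x, 0 <= k x <= 1) ->
  (Rintegral P setT k)%:E = (\int[P]_x (k x)%:E)%E.
Proof.
move=> mk k01; have /andP[I0 I1] := int01 P mk k01.
by rewrite /Rintegral fineK// ge0_fin_numE// (le_lt_trans I1)// ltry.
Qed.

Lemma integrable01 d (T : measurableType d) (P : probability T R) (k : T -> R) :
  measurable_fun setT k -> (forall x, 0 <= k x <= 1) -> P.-integrable setT (EFin \o k).
Proof.
move=> mk k01; apply/integrableP; split; first exact/measurable_EFinP.
rewrite (@eq_integral _ _ _ P setT (EFin \o k)).
  by rewrite -[X in (X < _)%E](Rintegral01_fineK P mk k01) ltry.
by move=> x _ /=; rewrite ger0_norm//; case/andP: (k01 x).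
Qed.

Let mfx x : measurable_fun setT (fun y => f (x, y)).
Proof. exact: (measurableT_comp mf (pair1_measurable x)). Qed.

Let mfy y : measurable_fun setT (fun x => f (x, y)).
Proof. exact: (measurableT_comp mf (pair2_measurable y)). Qed.

Lemma measurable_Rintegral_xsection :
  measurable_fun setT (fun x => Rintegral P2 setT (fun y => f (x, y))).
Proof.
rewrite /Rintegral; apply: measurableT_comp => //.
apply: (@measurable_fun_fubini_tonelli_F _ _ _ _ R P2 (EFin \o f)) => //.
by apply/measurable_EFinP.
Qed.

Lemma Rintegral_product1 :
  Rintegral (P1 \x P2)%E setT f = Rintegral P1 setT (fun x => Rintegral P2 setT (fun y => f (x, y))).
Proof.
rewrite {1}/Rintegral (@fubini_tonelli1 _ _ _ _ R P1 P2 (EFin \o f))//; last first.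
  by apply/measurable_EFinP.
rewrite /Rintegral; congr fine; apply: eq_integral => x _.
by rewrite -[RHS]/((Rintegral P2 setT (fun y => f (x, y)))%:E) Rintegral01_fineK.
Qed.

Lemma Rintegral_product2 :
  Rintegral (P1 \x P2)%E setT f = Rintegral P2 setT (fun y => Rintegral P1 setT (fun x => f (x, y))).
Proof.
rewrite {1}/Rintegral (@fubini_tonelli2 _ _ _ _ R P1 P2 (EFin \o f))//; last first.
  by apply/measurable_EFinP.
rewrite /Rintegral; congr fine; apply: eq_integral => y _.
by rewrite -[RHS]/((Rintegral P1 setT (fun x => f (x, y)))%:E) Rintegral01_fineK.
Qed.

End product_Rintegral.

(** * The Gaussian law on R^n as a nested product of normal laws *)

Section gauss_space.
Context {R : realType}.
Local Notation RT := (measurableTypeR R).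
Local Notation N := (@normal_prob R 0 1).

(** A measurable type is indexed by a display, and a product has a display of its own; display and
    type are therefore built together by recursion. *)
Fixpoint gspace_ (n : nat) : {d & measurableType d} :=
  if n is n'.+1
  then existT (fun d => measurableType d) _ (RT * projT2 (gspace_ n'))%type
  else existT (fun d => measurableType d) _ (unit : measurableType _).

Definition gspace (n : nat) : measurableType (projT1 (gspace_ n)) := projT2 (gspace_ n).

Fixpoint gprob (n : nat) : probability (gspace n) R :=
  match n return probability (gspace n) R with
  | 0 => \d_tt
  | n'.+1 => (N \x gprob n')%E
  end.

(** The shape and the default value 0 beyond the dimension are those of [gauss_iter], so that both
    feed the same argument to an integrand. *)
Fixpoint gcoord (n : nat) : gspace n -> nat -> R :=
  match n return gspace n -> nat -> R with
  | 0 => fun _ _ => 0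
  | n'.+1 => fun z k => if k is k'.+1 then gcoord z.2 k' else z.1
  end.

Definition grow (n : nat) (z : gspace n) : 'rV[R]_n := \row_i gcoord z i.

Definition consr (n : nat) (t : R) (v : 'rV[R]_n) : 'rV[R]_n.+1 :=
  \row_i oapp (v 0) t (unlift ord0 i).


Lemma grow_cons n (t : R) (z : gspace n) : @grow n.+1 (t, z) = consr t (grow z).
Proof.
apply/rowP => i; rewrite !mxE; case: unliftP => [j|] -> //=.
by rewrite mxE.
Qed.

Lemma consrD n (t t' : R) (v v' : 'rV[R]_n) : consr (t + t') (v + v') = consr t v + consr t' v'.
Proof. by apply/rowP => i; rewrite !mxE; case: unliftP => [j|] _ //=; rewrite mxE. Qed.

Lemma consrZ n (c t : R) (v : 'rV[R]_n) : consr (c * t) (c *: v) = c *: consr t v.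
Proof. by apply/rowP => i; rewrite !mxE; case: unliftP => [j|] _ //=; rewrite mxE. Qed.

Lemma consr0 n (t : R) (v : 'rV[R]_n) : consr t v 0 ord0 = t.
Proof. by rewrite mxE unlift_none. Qed.

Lemma consrS n (t : R) (v : 'rV[R]_n) i : consr t v 0 (lift ord0 i) = v 0 i.
Proof. by rewrite mxE liftK. Qed.

Lemma consr_eta n (v : 'rV[R]_n.+1) : v = consr (v 0 ord0) (\row_i v 0 (lift ord0 i)).
Proof. by apply/rowP => i; rewrite mxE; case: unliftP => [j|] -> //=; rewrite mxE. Qed.

Lemma measurable_gcoord n k : measurable_fun setT (fun z : gspace n => gcoord z k).
Proof.
elim: n k => [|n IH] [|k]; [exact: measurable_cst|exact: measurable_cst| |].
  exact: measurable_fst.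
exact: (@measurableT_comp _ _ _ _ _ _ (fun z : gspace n => gcoord z k) setT snd (IH k)
  measurable_snd).
Qed.

(** The sigma-algebra of [gspace n] is a product one and knows nothing of the topology of row
    vectors. A closed set is the intersection over m of the countable unions of those boxes of
    radius 1/(m+1) with rational centres that meet it, and boxes are measurable coordinate by
    coordinate. *)
Lemma measurable_closed_grow n (K : set 'rV[R]_n) : closed K ->
  measurable [set z : gspace n | K (grow z)].
Proof.
move=> cK.
pose box (q : 'rV[rat]_n) (e : R) := [set v : 'rV[R]_n | forall i, `|v 0 i - ratr (q 0 i)| < e].
pose Q m q := `[< exists2 k, K k & box q m.+1%:R^-1 k >].
have -> : [set z : gspace n | K (grow z)] =
  \bigcap_(m in [set: nat]) \bigcup_(q in [set q | Q m q]) [set z | box q m.+1%:R^-1 (grow z)].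
  apply/seteqP; split => z /=.
    move=> Kz m _.
    have ex i : exists q : rat, `|grow z 0 i - ratr q| < m.+1%:R^-1.
      have : grow z 0 i - m.+1%:R^-1 < grow z 0 i + m.+1%:R^-1.
        by rewrite ltrD2l (@lt_trans _ _ 0)// ?oppr_lt0 invr_gt0.
      move=> /rat_in_itvoo[q]; rewrite in_itv/= => /andP[q1 q2].
      exists q; move: q1 q2; move: (grow z 0 i) (ratr q : R) (m.+1%:R^-1 : R) => g r e q1 q2.
      by rewrite ltr_norml; apply/andP; split; lra.
    pose q : 'rV[rat]_n := \row_i projT1 (cid (ex i)).
    have qz : box q m.+1%:R^-1 (grow z).
      by move=> i; rewrite /q [X in ratr X]mxE; case: cid.
    by exists q => //; apply/asboolP; exists (grow z).
  move=> H; apply: cK => B /nbhs_ballP[e /= e0 eB].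
  have [m me] : exists m, (0 : R) + m.+1%:R^-1 < e / 2 by apply: ltr_add_invr; rewrite divr_gt0.
  rewrite add0r in me.
  have [q /asboolP[k Kk qk] qz] := H m I.
  exists k; split => //; apply: eB; split => // i j; rewrite (ord1 i) -ball_normE /=.
  have h1 := qk j; have h2 := qz j; rewrite distrC in h1.
  apply: le_lt_trans (ler_distD (ratr (q 0 j)) _ _) _.
  by rewrite (lt_trans (ltrD h2 h1))// [ltRHS]splitr ltrD.
apply: bigcapT_measurable => m; rewrite bigcup_mkcond.
apply: countable_bigcupT_measurable => // q; case: ifP => // _.
rewrite (_ : [set z | _] = \bigcap_(i in [set: 'I_n]) [set z | `|grow z 0 i - ratr (q 0 i)| < m.+1%:R^-1]).
  apply: fin_bigcap_measurable => // i _; apply: measurable_lt_set => //.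
  apply: measurableT_comp => //; apply: measurable_funB => //.
  rewrite (_ : (fun z => grow z 0 i) = (fun z => gcoord z i)); last by apply/funext => z; rewrite mxE.
  exact: measurable_gcoord.
by apply/seteqP; split => [z h i _|z h i]; exact: h.
Qed.

End gauss_space.

(** * The Gaussian measure of sets: slices, chords, log-concavity *)

Section gauss_of_sets.
Context {R : realType}.
Local Notation RT := (measurableTypeR R).
Local Notation N := (@normal_prob R 0 1).

(** [gspace n] has no vector structure, so midpoints are expressed through [grow]. By the induction
    hypothesis the integrals over the last n coordinates satisfy the midpoint inequality on the line
    as functions of the first coordinate. *)
Lemma prekopa_leindler_gspace n (f g h : @gspace R n -> R) :
  measurable_fun setT f -> measurable_fun setT g -> measurable_fun setT h ->
  (forall x, 0 <= f x <= 1) -> (forall x, 0 <= g x <= 1) -> (forall x, 0 <= h x <= 1) ->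
  (forall x y z, 2 *: grow z = grow x + grow y -> f x * g y <= h z ^+ 2) ->
  Rintegral (gprob n) setT f * Rintegral (gprob n) setT g <= Rintegral (gprob n) setT h ^+ 2.
Proof.
elim: n f g h => [f g h mf mg mh f01 g01 h01 fgh|n IH f g h mf mg mh f01 g01 h01 fgh].
  have E (k : @gspace R 0 -> R) : measurable_fun setT k -> Rintegral (gprob 0) setT k = k tt.
    move=> mk; rewrite /Rintegral /= (@integral_dirac _ unit tt R setT measurableT (EFin \o k)); last first.
      by apply/(@measurable_EFinP _ unit R setT k).
    by rewrite diracT mul1e.
  by rewrite !E//; apply: fgh; apply/rowP => -[].
rewrite (@Rintegral_product1 R _ _ RT (gspace n) N (gprob n) f mf f01).
rewrite (@Rintegral_product1 R _ _ RT (gspace n) N (gprob n) g mg g01).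
rewrite (@Rintegral_product1 R _ _ RT (gspace n) N (gprob n) h mh h01).
have slice (k : @gspace R n.+1 -> R) x : measurable_fun setT k ->
    measurable_fun setT (fun y => k (x, y)).
  by move=> mk; exact: (measurableT_comp mk (pair1_measurable x)).
have I01 (k : @gspace R n.+1 -> R) : measurable_fun setT k -> (forall x, 0 <= k x <= 1) ->
    forall x, 0 <= Rintegral (gprob n) setT (fun y => k (x, y)) <= 1.
  by move=> mk k01 x; apply: Rintegral01 => //; exact: slice.
apply: prekopa_leindler_std_normal; try exact: measurable_Rintegral_xsection; try exact: I01.
move=> x y; apply: IH; try exact: slice; try by move=> ?.
move=> x' y' z' xyz; apply: fgh; rewrite !grow_cons -consrD -consrZ xyz; congr consr.
by rewrite mulrC divfK.
Qed.

Definition gmeas n (A : set 'rV[R]_n) : R :=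
  Rintegral (gprob n) setT (fun z => \1_A (grow z)).

Definition chord n (A : set 'rV[R]_n.+1) (v : 'rV[R]_n) : set R := [set t | A (consr t v)].

Definition line_gauss (I : set R) : R := Rintegral N setT (\1_I : R -> R).

Lemma indic01 T (A : set T) x : 0 <= (\1_A x : R) <= 1.
Proof. by rewrite indicE; case: (_ \in _); rewrite ?lexx ?ler01. Qed.

Definition gmeasurable n (A : set 'rV[R]_n) := measurable [set z : gspace n | A (grow z)].

Lemma measurable_indic_grow n (A : set 'rV[R]_n) : gmeasurable A ->
  measurable_fun setT (fun z : gspace n => (\1_A (grow z) : R)).
Proof.
move=> mA; rewrite (_ : (fun z => _) = \1_[set z : gspace n | A (grow z)]).
  exact: measurable_indic.
by apply/funext => z; rewrite !indicE; congr (_%:R); apply/idP/idP; rewrite !inE.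
Qed.

Lemma gmeas01 n (A : set 'rV[R]_n) : gmeasurable A -> 0 <= gmeas A <= 1.
Proof.
move=> mA; apply: Rintegral01; first exact: measurable_indic_grow.
by move=> z; exact: indic01.
Qed.

Lemma le_gmeas n (A B : set 'rV[R]_n) : gmeasurable A -> gmeasurable B -> A `<=` B ->
  gmeas A <= gmeas B.
Proof.
move=> mA mB AB; have i01 (C : set 'rV[R]_n) : gmeasurable C ->
    (gprob n).-integrable setT (EFin \o (fun z : gspace n => (\1_C (grow z) : R))).
  move=> mC; apply: integrable01; first exact: measurable_indic_grow.
  by move=> z; exact: indic01.
apply: le_Rintegral => //; try exact: i01.
move=> z _; rewrite !indicE ler_nat; case: (boolP (_ \in A)) => // /set_mem Az.
by rewrite mem_set//; exact: AB.
Qed.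

(** Fubini with the first coordinate innermost, the order that suits estimates on chords;
    [gmeas_slice] takes the other order, which suits inductions on the dimension. *)
Lemma gmeas_chord n (A : set 'rV[R]_n.+1) : gmeasurable A ->
  gmeas A = Rintegral (gprob n) setT (fun z => line_gauss (chord A (grow z))).
Proof.
move=> mA.
refine (etrans (@Rintegral_product2 R _ _ RT (gspace n) N (gprob n)
  (fun z => \1_A (@grow R n.+1 z)) (measurable_indic_grow mA) (fun z => indic01 A _)) _).
apply: eq_Rintegral => z _; apply: eq_Rintegral => t _.
by rewrite grow_cons !indicE; congr (_%:R); apply/idP/idP; rewrite !inE.
Qed.

Lemma gmeas_slice n (A : set 'rV[R]_n.+1) : gmeasurable A ->
  gmeas A = Rintegral N setT (fun t => gmeas [set v | A (consr t v)]).
Proof.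
move=> mA.
refine (etrans (@Rintegral_product1 R _ _ RT (gspace n) N (gprob n)
  (fun z => \1_A (@grow R n.+1 z)) (measurable_indic_grow mA) (fun z => indic01 A _)) _).
apply: eq_Rintegral => t _; apply: eq_Rintegral => z _.
by rewrite grow_cons !indicE; congr (_%:R); apply/idP/idP; rewrite !inE.
Qed.

(** Prekopa-Leindler for indicators. It is the source of the log-concavity of the L_k. *)
Lemma gmeas_midpoint n (A B C : set 'rV[R]_n) : gmeasurable A -> gmeasurable B -> gmeasurable C ->
  (forall x y, A x -> B y -> C (2^-1 *: (x + y))) -> gmeas A * gmeas B <= gmeas C ^+ 2.
Proof.
move=> mA mB mC ABC; apply: prekopa_leindler_gspace; try exact: measurable_indic_grow;
  try by move=> z; exact: indic01.
move=> x y z xyz.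
rewrite !indicE; case: (boolP (_ \in A)) => [|_]; last by rewrite mul0r sqr_ge0.
rewrite inE => Ax; case: (boolP (_ \in B)) => [|_]; last by rewrite mulr0 sqr_ge0.
rewrite inE => By; rewrite mem_set ?expr1n ?mulr1//.
suff -> : grow z = 2^-1 *: (grow x + grow y) by exact: ABC.
by rewrite -xyz scalerA mulVf// scale1r.
Qed.

(** The iterated integral that defines [gauss_measure] is unfolded here only; afterwards the nested
    product law stands for it. *)
Lemma gauss_iterE n (f : (nat -> R) -> R) :
  measurable_fun setT (fun z : gspace n => f (gcoord z)) -> (forall y, 0 <= f y <= 1) ->
  gauss_iter n (fun y => (f y)%:E) = (Rintegral (gprob n) setT (fun z => f (gcoord z)))%:E.
Proof.
elim: n f => [f mf f01|n IH f mf f01] /=.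
  rewrite Rintegral01_fineK//= (@integral_dirac _ unit tt R setT measurableT
    (EFin \o (fun z => f (@gcoord R 0 z)))); last by apply/(@measurable_EFinP _ unit R setT).
  by rewrite diracT mul1e.
pose F t := Rintegral (gprob n) setT (fun z => f (@gcoord R n.+1 (t, z))).
have mFt t : measurable_fun setT (fun z => f (@gcoord R n.+1 (t, z))).
  exact: (measurableT_comp mf (pair1_measurable t)).
have F01 t : 0 <= F t <= 1 by apply: Rintegral01.
have mF : measurable_fun setT (F : RT -> R).
  exact: (@measurable_Rintegral_xsection _ _ _ _ _ _ (fun z : gspace n.+1 => f (gcoord z))).
have -> : Rintegral (gprob n.+1) setT (fun z : gspace n.+1 => f (gcoord z)) = Rintegral N setT F.
  by rewrite Rintegral_product1.
rewrite Rintegral01_fineK// integral_std_normal//; last by move=> t; case/andP: (F01 t).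
apply: eq_integral => t _; rewrite EFinM; congr (_ * _)%E.
exact: (IH (fun y => f (fun k => if k is k'.+1 then y k' else t)) (mFt t) (fun=> f01 _)).
Qed.

Lemma gauss_measureE n (A : set 'rV[R]_n) : gmeasurable A -> gauss_measure A = (gmeas A)%:E.
Proof.
move=> mA; rewrite /gauss_measure.
rewrite (@gauss_iterE n (fun y => \1_A (\row_(i < n) y i)))//.
  exact: measurable_indic_grow.
by move=> y; exact: indic01.
Qed.

End gauss_of_sets.

(** * Continuity and compactness for row vectors *)

Section row_vector_topology.
Context {R : realType}.

Lemma continuous_rV (T : topologicalType) n (f : T -> 'rV[R]_n) :
  (forall i, continuous (fun x => f x 0 i)) -> continuous f.
Proof.
move=> cf x A /nbhs_ballP[e /= e0 eA].
have : \forall y \near x, forall i : 'I_n, ball (f x 0 i) e (f y 0 i).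
  by apply: filter_forall => i; apply: (cf i x); exact: nbhsx_ballx.
apply: filterS => y fxy; apply: eA; split => // i j; rewrite (ord1 i); exact: fxy.
Qed.

Lemma compact_closed_rV n (K : set 'rV[R]_n) : compact K -> closed K.
Proof. by apply: compact_closed; exact: norm_hausdorff. Qed.

Lemma compact_gmeasurable n (K : set 'rV[R]_n) : compact K -> gmeasurable K.
Proof. by move=> cK; apply: measurable_closed_grow; exact: compact_closed_rV. Qed.

Lemma continuous_compact_image (T U : topologicalType) (f : T -> U) (A : set T) :
  continuous f -> compact A -> compact (f @` A).
Proof. by move=> cf; apply: continuous_compact; exact: continuous_subspaceT. Qed.

End row_vector_topology.

(** * Invariance of the Gaussian measure under linear isometries and central symmetry *)

Section gauss_invariance.
Context {R : realType}.
Local Notation RT := (measurableTypeR R).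
Local Notation N := (@normal_prob R 0 1).

Lemma nested_RintegralE (f : RT * RT -> R) : measurable_fun setT f -> (forall z, 0 <= f z <= 1) ->
  (Rintegral N setT (fun x => Rintegral N setT (fun y => f (x, y))))%:E =
  (\int[N]_x \int[N]_y (f (x, y))%:E)%E.
Proof.
move=> mf f01.
have mfx x : measurable_fun setT (fun y => f (x, y)).
  exact: (measurableT_comp mf (pair1_measurable x)).
rewrite Rintegral01_fineK.
- by apply: eq_integral => x _; rewrite Rintegral01_fineK.
- exact: (measurable_Rintegral_xsection N mf f01).
- by move=> x; apply: Rintegral01.
Qed.

Definition plane_rot n (c s : R) (v : 'rV[R]_n.+2) : 'rV[R]_n.+2 :=
  \row_i (if i == ord0 then c * v 0 ord0 - s * v 0 (lift ord0 ord0)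
          else if i == lift ord0 ord0 then s * v 0 ord0 + c * v 0 (lift ord0 ord0)
          else v 0 i).

Lemma plane_rot_consr n (c s x y : R) (v : 'rV[R]_n) :
  plane_rot c s (consr x (consr y v)) = consr (c * x - s * y) (consr (s * x + c * y) v).
Proof.
apply/rowP => i; rewrite !mxE.
case: (unliftP ord0 i) => [j|] ->; rewrite ?eqxx ?liftK ?unlift_none //=; last first.
  by rewrite mxE unlift_none.
rewrite (inj_eq (@lift_inj _ _)) !mxE.
case: (unliftP ord0 j) => [k|] ->; rewrite ?unlift_none ?liftK//=; last first.
Qed.

(** Only the first two coordinates move: slicing twice leaves a planar integral whose integrand is
    the measure of the remaining slice. *)
Lemma gmeas_plane_rot n (c s : R) (A : set 'rV[R]_n.+2) : s != 0 -> c ^+ 2 + s ^+ 2 = 1 ->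
  gmeasurable A -> gmeasurable [set v | A (plane_rot c s v)] ->
  gmeas [set v | A (plane_rot c s v)] = gmeas A.
Proof.
move=> s0 cs mA mA'.
have slice (B : set 'rV[R]_n.+2) x : gmeasurable B -> gmeasurable [set v | B (consr x v)].
  move=> mB; have := measurable_xsection x mB; congr measurable.
  by apply/seteqP; split => z; [move=> /xsectionP|move=> ?; apply/xsectionP]; rewrite /= grow_cons.
pose f (B : set 'rV[R]_n.+2) (z : RT * RT) := gmeas [set v | B (consr z.1 (consr z.2 v))].
have E (B : set 'rV[R]_n.+2) : gmeasurable B ->
    gmeas B = Rintegral N setT (fun x => Rintegral N setT (fun y => f B (x, y))).
  move=> mB; rewrite gmeas_slice//; apply: eq_Rintegral => x _.
  by rewrite gmeas_slice//; exact: slice.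
pose k (z : (RT * RT) * gspace n) : R := \1_A (consr z.1.1 (consr z.1.2 (grow z.2))).
have mk : measurable_fun setT k.
  pose r (z : (RT * RT) * gspace n) : gspace n.+2 := (z.1.1, (z.1.2, z.2)).
  have mr : measurable_fun setT r.
    apply: measurable_fun_pair; first exact: (measurableT_comp measurable_fst measurable_fst).
    apply: measurable_fun_pair; last exact: measurable_snd.
    exact: (measurableT_comp measurable_snd measurable_fst).
  have := measurableT_comp (measurable_indic_grow mA) mr; congr measurable_fun.
  by apply/funext => z; rewrite /= /r !grow_cons.
have mf : measurable_fun setT (f A).
  apply: (measurable_Rintegral_xsection (gprob n) mk) => z; exact: indic01.
have f01 z : 0 <= f A z <= 1.
  apply: Rintegral01 => [|y]; last exact: indic01.
  exact: (measurableT_comp mk (pair1_measurable z)).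
pose f' (z : RT * RT) := f A ((c * (z.1 : R) - s * (z.2 : R))%R, (s * (z.1 : R) + c * (z.2 : R))%R).
have mf' : measurable_fun setT f' by exact: (measurableT_comp mf (measurable_rotation c s)).
have e : Rintegral N setT (fun x => Rintegral N setT (fun y => f' (x, y))) =
    Rintegral N setT (fun x => Rintegral N setT (fun y => f A (x, y))).
  apply: EFin_inj.
  exact: (etrans (etrans (nested_RintegralE mf' (fun z => f01 _))
  (integral_std_normal_rotation s0 cs mf f01)) (esym (nested_RintegralE mf f01))).
refine (etrans (E _ mA') (etrans _ (etrans e (esym (E _ mA))))).
apply: eq_Rintegral => x _; apply: eq_Rintegral => y _.
rewrite /f' /f /=; congr gmeas; apply/seteqP.
by split => v /=; rewrite plane_rot_consr.
Qed.


Lemma plane_rotP n (c s : R) : linear (@plane_rot n c s).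
Proof.
move=> b v w; apply/rowP => i; rewrite !mxE; case: ifP => _; first by ring.
by case: ifP => _ //; ring.
Qed.

Lemma plane_rot_inj n (c s : R) : c ^+ 2 + s ^+ 2 = 1 -> injective (@plane_rot n c s).
Proof.
move=> cs; apply: (can_inj (g := @plane_rot n c (- s))) => v.
rewrite [v]consr_eta [X in consr _ X]consr_eta !plane_rot_consr; congr consr; last congr consr.
all: move: cs; move: (v 0 _) => x; move: ((\row_i _) 0 _) => y; move=> cs.
all: rewrite -[RHS]mul1r -cs; ring.
Qed.

Lemma plane_rot_continuous n (c s : R) : continuous (@plane_rot n c s).
Proof.
have cc i : continuous (fun v : 'rV[R]_n.+2 => v 0 i) by exact: coord_continuous.
have cM b i : continuous (fun v : 'rV[R]_n.+2 => b * v 0 i).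
  by move=> x; apply: continuousM; [exact: cst_continuous|exact: cc].
apply: continuous_rV => i; case: (eqVneq i ord0) => [->|i0].
  rewrite (_ : (fun _ => _) = (fun v : 'rV[R]_n.+2 => c * v 0 ord0 - s * v 0 (lift ord0 ord0))).
    by move=> x; apply: (cvgB (cM c ord0 x) (cM s (lift ord0 ord0) x)).
  by apply/funext => v; rewrite mxE eqxx.
case: (eqVneq i (lift ord0 ord0)) => [->|i1].
  rewrite (_ : (fun _ => _) = (fun v : 'rV[R]_n.+2 => s * v 0 ord0 + c * v 0 (lift ord0 ord0))).
    by move=> x; apply: (cvgD (cM s ord0 x) (cM c (lift ord0 ord0) x)).
  by apply/funext => v; rewrite mxE.
rewrite (_ : (fun _ => _) = (fun v : 'rV[R]_n.+2 => v 0 i)); first exact: cc.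
by apply/funext => v; rewrite mxE (negbTE i0) (negbTE i1).
Qed.

(** Invariance is asked of preimages of closed sets, whose measurability [measurable_closed_grow]
    provides; injectivity turns it into invariance of images of compact sets. *)
Definition gauss_isometry n (rho : 'rV[R]_n -> 'rV[R]_n) :=
  [/\ linear rho, continuous rho, injective rho &
      forall A, closed A -> gmeas [set v | A (rho v)] = gmeas A].

Lemma gauss_isometry_image n (rho : 'rV[R]_n -> 'rV[R]_n) K : gauss_isometry rho ->
  compact K -> gmeas (rho @` K) = gmeas K.
Proof.
move=> [lrho crho irho mrho] cK; rewrite -mrho.
  by congr gmeas; apply/seteqP; split => v /= => [[k Kk /irho <-//]|Kv]; exists v.
by apply: compact_closed_rV; exact: continuous_compact_image.
Qed.

Definition tailr n (v : 'rV[R]_n.+1) : 'rV[R]_n := \row_i v 0 (lift ord0 i).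

Lemma tailr_consr n t (v : 'rV[R]_n) : tailr (consr t v) = v.
Proof. by apply/rowP => i; rewrite mxE consrS. Qed.

Lemma continuous_consr (T : topologicalType) n (f : T -> R) (g : T -> 'rV[R]_n) :
  continuous f -> continuous g -> continuous (fun x => consr (f x) (g x)).
Proof.
move=> cf cg; apply: continuous_rV => i; case: (unliftP ord0 i) => [j|] ->.
  rewrite (_ : (fun _ => _) = (fun x => g x 0 j)); last by apply/funext => x; rewrite consrS.
  by move=> x; apply: (@continuous_comp _ _ _ g (fun v : 'rV[R]_n => v 0 j) x (cg x) (@coord_continuous R 1 n 0 j (g x))).
by rewrite (_ : (fun _ => _) = f)//; apply/funext => x; rewrite consr0.
Qed.

Lemma continuous_tailr n : continuous (@tailr n).
Proof.
apply: continuous_rV => i.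
rewrite (_ : (fun _ => _) = (fun v : 'rV[R]_n.+1 => v 0 (lift ord0 i))); first exact: (@coord_continuous R 1 n.+1 0 (lift ord0 i)).
by apply/funext => v; rewrite mxE.
Qed.

Lemma closed_continuous_preimage (T U : topologicalType) (f : T -> U) (A : set U) :
  continuous f -> closed A -> closed [set x | A (f x)].
Proof. by move=> cf cA; apply: (preimage_closed _ cA) => x _; exact: cf. Qed.

Lemma gauss_isometry_tail n (rho : 'rV[R]_n -> 'rV[R]_n) : gauss_isometry rho ->
  gauss_isometry (fun v : 'rV[R]_n.+1 => consr (v 0 ord0) (rho (tailr v))).
Proof.
move=> [lrho crho irho mrho].
have cr : continuous (fun v : 'rV[R]_n.+1 => consr (v 0 ord0) (rho (tailr v))).
  apply: continuous_consr; first exact: (@coord_continuous R 1 n.+1 0 ord0).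
  by move=> x; apply: continuous_comp; [exact: continuous_tailr|exact: crho].
split => //.
- move=> a v w; rewrite -consrZ -consrD !mxE; congr consr; rewrite -lrho; congr rho.
  by apply/rowP => i; rewrite !mxE.
- move=> v w e; rewrite [v]consr_eta [w]consr_eta; congr consr.
    by have := congr1 (fun u : 'rV[R]_n.+1 => u 0 ord0) e; rewrite !consr0.
  by apply: irho; have := congr1 (@tailr n) e; rewrite !tailr_consr.
- move=> A cA.
  rewrite gmeas_slice; last first.
    by apply: measurable_closed_grow; exact: (closed_continuous_preimage cr cA).
  rewrite gmeas_slice; last exact: measurable_closed_grow.
  apply: eq_Rintegral => t _; rewrite -[RHS]mrho.
    congr gmeas; apply/seteqP; split => v /=; rewrite consr0 tailr_consr; exact.
  apply: (closed_continuous_preimage _ cA); apply: continuous_consr; first exact: cst_continuous.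
  by move=> x; exact: cvg_id.
Qed.

Lemma gauss_isometry_id n : gauss_isometry (@id 'rV[R]_n).
Proof. by split => // x; exact: cvg_id. Qed.

Lemma gauss_isometry_comp n (rho1 rho2 : 'rV[R]_n -> 'rV[R]_n) :
  gauss_isometry rho1 -> gauss_isometry rho2 -> gauss_isometry (rho2 \o rho1).
Proof.
move=> [l1 c1 i1 m1] [l2 c2 i2 m2]; split.
- by move=> a v w /=; rewrite l1 l2.
- by move=> x; apply: continuous_comp; [exact: c1|exact: c2].
- exact: inj_comp.
- move=> A cA; rewrite -(m2 A cA); exact: (m1 _ (closed_continuous_preimage c2 cA)).
Qed.

Lemma gauss_isometry_plane_rot n (c s : R) : s != 0 -> c ^+ 2 + s ^+ 2 = 1 ->
  gauss_isometry (@plane_rot n c s).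
Proof.
move=> s0 cs; split; [exact: plane_rotP|exact: plane_rot_continuous|exact: plane_rot_inj|].
move=> A cA; apply: gmeas_plane_rot => //; first exact: measurable_closed_grow.
apply: measurable_closed_grow; exact: (closed_continuous_preimage (@plane_rot_continuous n c s) cA).
Qed.

(** Givens rotations: the induction hypothesis aligns the tail with its first axis, and one rotation
    of the first two coordinates finishes. The sign of [a] is left open. *)
Lemma gauss_isometry_align n (u : 'rV[R]_n.+1) : exists rho (a : R),
  [/\ gauss_isometry rho, rho u = consr a 0 & a ^+ 2 = \sum_i u 0 i ^+ 2].
Proof.
elim: n u => [|n IH] u.
  exists id, (u 0 ord0); split; first exact: gauss_isometry_id.
    by rewrite [LHS]consr_eta; congr consr; apply/rowP => -[].
  by rewrite big_ord1.
have [rho [b [irho rhou b2]]] := IH (tailr u).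
have irho' := gauss_isometry_tail irho.
set rho' := (fun v => _) in irho'.
have rho'u : rho' u = consr (u 0 ord0) (consr b 0) by rewrite /rho' rhou.
have sumu : \sum_i u 0 i ^+ 2 = u 0 ord0 ^+ 2 + b ^+ 2.
  by rewrite big_ord_recl b2; congr (_ + _); apply: eq_bigr => i _; rewrite mxE.
(* For b = 0 nothing is left to rotate; the rotation used otherwise has sine - b / a, which must not
   vanish. *)
have [b0|b0] := eqVneq b 0.
  exists rho', (u 0 ord0); split => //; last by rewrite sumu b0 expr0n/= addr0.
  by rewrite rho'u b0; congr consr; apply/rowP => i; rewrite !mxE; case: unliftP => [j|] _ //=; rewrite mxE.
pose a := Num.sqrt (u 0 ord0 ^+ 2 + b ^+ 2).
have s2 : 0 < u 0 ord0 ^+ 2 + b ^+ 2 by rewrite ltr_wpDl ?sqr_ge0// exprn_even_gt0.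
have a0 : a != 0 by rewrite gt_eqF// sqrtr_gt0.
have a2 : a ^+ 2 = u 0 ord0 ^+ 2 + b ^+ 2 by rewrite sqr_sqrtr// ltW.
exists (plane_rot (u 0 ord0 / a) (- (b / a)) \o rho'), a; split.
- apply: gauss_isometry_comp => //; apply: gauss_isometry_plane_rot.
    by rewrite oppr_eq0 mulf_neq0// invr_eq0.
  by rewrite sqrrN !expr_div_n -mulrDl -a2 divff// expf_neq0.
- rewrite /= rho'u plane_rot_consr; congr consr.
    rewrite mulNr opprK mulrAC -expr2 (mulrAC b) -expr2 -mulrDl -a2 expr2 mulfK//.
  rewrite (_ : _ + _ = 0); last by ring.
  by apply/rowP => i; rewrite !mxE; case: unliftP => [j|] _ //=; rewrite mxE.
- by rewrite a2 sumu.
Qed.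

Lemma Rintegral_std_normalN (f : R -> R) : measurable_fun setT f -> (forall x, 0 <= f x <= 1) ->
  Rintegral N setT (fun x => f (- x)) = Rintegral N setT f.
Proof.
move=> mf f01; have f0 x : 0 <= f x by case/andP: (f01 x).
have mN : measurable_fun setT (-%R : RT -> RT) by exact: oppr_measurable.
rewrite /Rintegral integral_std_normal//; last exact: measurableT_comp.
rewrite integral_std_normal//; congr fine.
have mk : measurable_fun setT (fun x : RT => (normal_pdf 0 1 x * f x)%:E).
  apply/measurable_EFinP; apply: (@measurable_funM _ RT R) => //; exact: measurable_normal_pdf.
have := @ge0_integral_pushforward _ _ RT RT R _ mN lebesgue_measure setT _ measurableT mk.
rewrite /= => e; rewrite [RHS](_ : _ =
    \int[pushforward lebesgue_measure (-%R : RT -> RT)]_x (normal_pdf 0 1 x * f x)%:E)%E.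
  rewrite e; last by move=> ? _; rewrite lee_fin mulr_ge0 ?normal_pdf_ge0.
  by apply: eq_integral => x _ /=; rewrite !std_normal_pdfE sqrrN.
by apply: eq_measure_integral => A mA _; rewrite -[LHS](lebesgue_measureN mA).
Qed.

(** One coordinate at a time: the slice at t of the reflected set is the reflection of the slice at
    - t. *)
Lemma gmeasN n (A : set 'rV[R]_n) : closed A -> gmeas [set v | A (- v)] = gmeas A.
Proof.
have cN m : continuous (fun v : 'rV[R]_m => - v) by exact: opp_continuous.
elim: n A => [|n IH] A cA.
  by congr gmeas; apply/seteqP; split => v /=; rewrite [v](_ : _ = 0) ?oppr0//; apply/rowP => -[].
have mAN : gmeasurable [set v | A (- v)].
  by apply: measurable_closed_grow; exact: (closed_continuous_preimage (@cN n.+1) cA).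
have cs t : closed [set v | A (consr t v)].
  apply: (closed_continuous_preimage _ cA); apply: continuous_consr; first exact: cst_continuous.
  by move=> x; exact: cvg_id.
have mA : gmeasurable A by exact: measurable_closed_grow.
have mk := measurable_indic_grow mA.
have i01 (z : gspace n.+1) : 0 <= (\1_A (grow z) : R) <= 1 by exact: indic01.
pose F (t : R) := gmeas [set v | A (consr t v)].
have F01 t : 0 <= F t <= 1 by apply: gmeas01; exact: measurable_closed_grow.
have mF : measurable_fun setT (F : RT -> R).
  rewrite (_ : F = fun t => Rintegral (gprob n) setT (fun z => \1_A (@grow R n.+1 (t, z)))).
    exact: (measurable_Rintegral_xsection (gprob n) mk i01).
  apply/funext => t; apply: eq_Rintegral => z _.
  by rewrite grow_cons !indicE; congr (_%:R); apply/idP/idP; rewrite !inE.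
refine (etrans (gmeas_slice mAN) (etrans _ (etrans (Rintegral_std_normalN mF F01)
  (esym (gmeas_slice mA))))).
apply: eq_Rintegral => t _; refine (etrans _ (IH _ (cs (- t)))); congr gmeas; apply/seteqP.
by split => v /=; rewrite -[- consr t v]scaleN1r -consrZ mulN1r scaleN1r.
Qed.

End gauss_invariance.

(** * The Gaussian measure of an interval and of its symmetric enlargement *)

Section chord_estimates.
Context {R : realType}.
Local Notation RT := (measurableTypeR R).
Local Notation mu := (@lebesgue_measure R).
Local Notation phi := (@normal_pdf R 0 1).

Lemma measurable_indic_line (I : set R) : measurable I -> measurable_fun setT (\1_I : R -> R).
Proof. by move=> mI; exact: measurable_indic. Qed.

Lemma line_gaussE (I : set R) : measurable I ->
  (line_gauss I)%:E = (\int[mu]_(x in I) (phi x)%:E)%E.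
Proof.
move=> mI; rewrite /line_gauss Rintegral01_fineK; last 2 first.
- exact: measurable_indic_line.
- by move=> x; exact: indic01.
by rewrite integral_indic// setIT.
Qed.

Lemma line_gauss01 (I : set R) : measurable I -> 0 <= line_gauss I <= 1.
Proof.
move=> mI; apply: Rintegral01; first exact: measurable_indic_line.
by move=> x; exact: indic01.
Qed.

Lemma le_line_gauss (I J : set R) : measurable I -> measurable J -> I `<=` J ->
  line_gauss I <= line_gauss J.
Proof.
move=> mI mJ IJ; rewrite -lee_fin (line_gaussE mI) (line_gaussE mJ).
apply: ge0_subset_integral => //.
  by apply/measurable_EFinP/measurable_funTS; exact: measurable_normal_pdf.
by move=> x _; rewrite lee_fin normal_pdf_ge0.
Qed.

Lemma line_gauss_set0 : line_gauss (set0 : set R) = 0.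
Proof. by apply: EFin_inj; rewrite line_gaussE// integral_set0. Qed.

Lemma line_gaussN (I : set R) : measurable I -> line_gauss [set x | I (- x)] = line_gauss I.
Proof.
move=> mI; rewrite /line_gauss -[RHS]Rintegral_std_normalN; last 2 first.
- exact: measurable_indic_line.
- by move=> x; exact: indic01.
by apply: eq_Rintegral => x _; rewrite !indicE.
Qed.

Lemma measurable_std_normal_pdf_translate (c : R) : measurable_fun setT (fun x : RT => phi ((x : R) + c)).
Proof.
apply: (@measurableT_comp _ _ _ RT RT R phi); first exact: measurable_normal_pdf.
exact: (@measurable_funD _ RT R setT id (cst c)).
Qed.

Lemma line_gauss_translate (c r : R) :
  (line_gauss `[(c - r), (c + r)]%classic)%:E =
  (\int[mu]_(x in `[(- r)%R, r]) (phi ((x : R) + c)%R)%:E)%E.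
Proof.
rewrite (line_gaussE (measurable_itv _)).
refine (etrans (integral_mkcond _ _) (etrans _ (esym (integral_mkcond _ _)))).
rewrite -(ge0_integral_translate c).
- apply: eq_integral => x _; rewrite !patchE; congr (if _ then _ else _).
  have E (y : R) : (c - r <= y + c <= c + r) = (- r <= y <= r).
    by apply/idP/idP => /andP[? ?]; apply/andP; split; lra.
  by apply/idP/idP; rewrite !inE /= !in_itv /= => h; [rewrite -(E x)|rewrite (E x)].
- apply/(measurable_restrictT _ _).1 => //; apply/measurable_EFinP.
  by apply: measurable_funTS; exact: measurable_normal_pdf.
- by move=> x; rewrite patchE; case: ifP => _ //; rewrite lee_fin normal_pdf_ge0.
Qed.

(* The standard normal density folded about the centre c of an interval: it factors as the
   decreasing exp (- x^2 / 2) times a function increasing in |x|. *)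
Let folded_pdf (c x : R) := phi (x + c) + phi (x - c).

(** The intervals of radius r about c and - c have the same measure; adding the two integrals, each
    translated to [-r, r], produces the folded density. *)
Lemma line_gauss_double (c r : R) :
  (2 * line_gauss `[(c - r), (c + r)]%classic)%:E = (\int[mu]_(x in `[(- r)%R, r]) (folded_pdf c x)%:E)%E.
Proof.
have e : line_gauss `[(c - r), (c + r)]%classic = line_gauss `[(- c - r), (- c + r)]%classic.
  rewrite -line_gaussN//; congr line_gauss; apply/seteqP.
  by split => x /=; rewrite !in_itv/= => /andP[? ?]; apply/andP; split; lra.
rewrite (_ : 2 * _ = line_gauss `[(c - r), (c + r)]%classic +
  line_gauss `[(- c - r), (- c + r)]%classic); last by rewrite -e; ring.
rewrite EFinD !line_gauss_translate -ge0_integralD//.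
- by move=> x _; rewrite lee_fin normal_pdf_ge0.
- by apply/measurable_EFinP/measurable_funTS; exact: measurable_std_normal_pdf_translate.
- by move=> x _; rewrite lee_fin normal_pdf_ge0.
- by apply/measurable_EFinP/measurable_funTS; exact: measurable_std_normal_pdf_translate.
Qed.

Lemma folded_pdfE (c x : R) : folded_pdf c x = normal_peak 1 * expR (- (c ^+ 2 / 2)) * expR (- (x ^+ 2 / 2)) *
  (expR (c * x) + expR (- (c * x))).
Proof.
rewrite /folded_pdf !std_normal_pdfE -!mulrA -mulrDr; congr (_ * _).
rewrite mulrDr mulrDr -!expRD addrC; congr (expR _ + expR _); by field.
Qed.

Lemma cosh_mono (c x y : R) : `|x| <= `|y| ->
  expR (c * x) + expR (- (c * x)) <= expR (c * y) + expR (- (c * y)).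
Proof.
move=> xy.
have abs z : expR (c * z) + expR (- (c * z)) = expR `|c * z| + expR (- `|c * z|).
  by have [_|_] := ger0P (c * z); rewrite // opprK addrC.
rewrite (abs x) (abs y); have : `|c * x| <= `|c * y| by rewrite !normrM ler_wpM2l.
have : 0 <= `|c * x| by [].
move: `|c * x| `|c * y| => p q p0 pq; rewrite !expRN.
have p1 : 1 <= expR p by rewrite -expR0 ler_expR.
have pq' : expR p <= expR q by rewrite ler_expR.
move: (expR p) (expR q) p1 pq' => P Q P1 PQ.
have P0 : 0 < P by lra.
have Q0 : 0 < Q by lra.
(* P <= Q are the exponentials of |c x| and |c y|, both at least 1; the factorization shows that t +
   1/t increases for t >= 1. *)
rewrite -subr_ge0 (_ : _ - _ = (Q - P) * (1 - (P * Q)^-1)).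
  apply: mulr_ge0; first lra.
  by rewrite subr_ge0 invf_le1 ?mulr_gt0//; nra.
by field; rewrite !gt_eqF.
Qed.

(* The increasing factor is at most w on [-r, r] and at least w on the two added pieces. *)
Lemma line_gauss_gain (c r h : R) : 0 < r -> 0 <= h ->
  (1 + h * expR (- ((r + h) ^+ 2 / 2)) / r) * line_gauss `[(c - r), (c + r)]%classic <=
  line_gauss `[(c - (r + h)), (c + (r + h))]%classic.
Proof.
move=> r0 h0.
have pk : 0 < normal_peak 1 :> R by rewrite normal_peak_gt0// oner_eq0.
pose w := normal_peak 1 * expR (- (c ^+ 2 / 2)) * (expR (c * r) + expR (- (c * r))).
have w0 : 0 <= w by rewrite !mulr_ge0 ?expR_ge0 ?addr_ge0 ?expR_ge0// ltW.
have mW (D : set R) : measurable_fun D (fun x : RT => (folded_pdf c x)%:E).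
  by apply/measurable_EFinP/measurable_funTS; apply: measurable_funD; exact: measurable_std_normal_pdf_translate.
have W0 (x : R) : (0 <= (folded_pdf c x)%:E)%E by rewrite lee_fin addr_ge0 ?normal_pdf_ge0.
have up : (\int[mu]_(x in `[(- r)%R, r]) (folded_pdf c x)%:E <= (2 * r * w)%:E)%E.
  apply: (@le_trans _ _ (\int[mu]_(x in `[(- r)%R, r]) (cst w%:E x))%E).
    apply: ge0_le_integral => //=.
    exact: mW.
    move=> x; rewrite in_itv/= => xr; rewrite lee_fin folded_pdfE /w.
    rewrite -mulrA ler_pM2l ?mulr_gt0 ?expR_gt0//.
    rewrite -[leRHS]mul1r ler_pM ?expR_ge0 ?addr_ge0 ?expR_ge0//.
      by rewrite -[leRHS]expR0 ler_expR oppr_le0 divr_ge0// sqr_ge0.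
    by apply: cosh_mono; rewrite (ger0_norm (ltW r0)) ler_norml.
  rewrite integral_cst//= lebesgue_measure_itv/= lte_fin.
  by rewrite (_ : - r < r); [rewrite -EFinD -EFinM lee_fin; lra|lra].
pose D := `[(- (r + h))%R, (r + h)%R]%classic `\` `[(- r)%R, r]%classic.
have mD : measurable D by exact: measurableD.
have spl : (\int[mu]_(x in `[(- (r + h))%R, (r + h)%R]) (folded_pdf c x)%:E =
    \int[mu]_(x in `[(- r)%R, r]) (folded_pdf c x)%:E + \int[mu]_(x in D) (folded_pdf c x)%:E)%E.
  rewrite -ge0_integral_setU//; last by apply/disj_setPS => x [xr []].
  rewrite setUC setDKU// => x /=; rewrite !in_itv/= => /andP[? ?]; apply/andP; split; lra.
  exact: mW.
have muD : mu D = (2 * h)%:E.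
  rewrite measureD//= ?lebesgue_measure_itv/= ?lte_fin.
  - rewrite setIC (setIidl _) ?lebesgue_measure_itv/= ?lte_fin; last first.
      by move=> x /=; rewrite !in_itv/= => /andP[? ?]; apply/andP; split; lra.
    have -> : (- (r + h) < r + h) by lra.
    have -> : (- r < r) by lra.
    by rewrite -!EFinD; congr (_%:E); lra.
  - have -> : (- (r + h) < r + h) by lra.
    by rewrite -EFinD ltry.
have low : ((2 * h * (expR (- ((r + h) ^+ 2 / 2)) * w))%:E <= \int[mu]_(x in D) (folded_pdf c x)%:E)%E.
  apply: (@le_trans _ _ (\int[mu]_(x in D) (cst (expR (- ((r + h) ^+ 2 / 2)) * w)%:E x))%E).
    by rewrite integral_cst//= muD -EFinM lee_fin mulrC.
  apply: ge0_le_integral => //.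
  - by move=> x _; rewrite lee_fin mulr_ge0 ?expR_ge0.
  - exact: mW.
  - move=> x []; rewrite /= !in_itv/= => /andP[x1 x2] x3; rewrite lee_fin folded_pdfE /w.
    rewrite mulrCA -[leRHS]mulrA ler_pM2l ?mulr_gt0 ?expR_gt0//.
    have ax : r <= `|x| by rewrite leNgt; apply/negP => xr; apply: x3; rewrite -ler_norml ltW.
    rewrite ler_pM ?expR_ge0 ?addr_ge0 ?expR_ge0//; last first.
      by apply: cosh_mono; rewrite (ger0_norm (ltW r0)).
    rewrite ler_expR lerN2 ler_pM2r//.
    have xn : `|x| ^+ 2 = (x : R) ^+ 2 by rewrite real_normK// num_real.
    rewrite -[leLHS]xn ler_pXn2r ?nnegrE ?addr_ge0 ?(ltW r0)// ler_norml.
    by apply/andP; split.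
move: up low spl; rewrite -!line_gauss_double.
set A := line_gauss _; set B := line_gauss _ => up low spl.
have up' : 2 * A <= 2 * r * w by rewrite -lee_fin.
have : (2 * A + 2 * h * (expR (- ((r + h) ^+ 2 / 2)) * w) <= 2 * B).
  by rewrite -lee_fin spl EFinD leeD2l.
set e := expR _ => H.
have e0 : 0 < e by exact: expR_gt0.
rewrite mulrDl mul1r.
suff : h * e / r * A <= h * e * w by lra.
have he0 : 0 <= h * e by rewrite mulr_ge0 ?(ltW e0).
rewrite -mulrA ler_wpM2l// mulrC ler_pdivrMr//; lra.
Qed.

Lemma line_gauss_le_length (a b : R) : a <= b ->
  line_gauss `[a, b]%classic <= normal_peak 1 * (b - a).
Proof.
move=> ab; rewrite -lee_fin line_gaussE//=.
apply: (@le_trans _ _ (\int[mu]_(x in `[a, b]) (cst (normal_peak 1)%:E x))%E).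
  apply: ge0_le_integral => //=.
  - by move=> x _; rewrite lee_fin normal_pdf_ge0.
  - by apply/measurable_EFinP/measurable_funTS; exact: measurable_normal_pdf.
  - by move=> x _; rewrite lee_fin normal_pdf_ub// oner_eq0.
rewrite integral_cst//= lebesgue_measure_itv/= lte_fin.
by case: ltP => _; rewrite ?mule0 -?EFinD -?EFinM lee_fin// mulr_ge0 ?normal_peak_ge0 ?subr_ge0.
Qed.

End chord_estimates.

(** * The numerical inequality between gain and loss for log-concave sequences *)

Section log_concave_sequences.
Context {R : realType}.

Lemma summation_by_parts (w A : nat -> R) m :
  \sum_(j < m) w j * (A j - A j.+1) + w m * A m =
  w 0%N * A 0%N - \sum_(j < m) (w j - w j.+1) * A j.+1.
Proof.
elim: m => [|m IH]; first by rewrite !big_ord0 add0r subr0.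
rewrite !big_ord_recr /=; move: IH; set s := \sum_(_ < _) _; set t := \sum_(_ < _) _ => IH.
have -> : s = w 0%N * A 0%N - t - w m * A m by rewrite -IH addrK.
by ring.
Qed.

(** After summation by parts the terms of [A] beyond the first have nonpositive coefficients, so
    replacing them by their geometric bounds can only lower the sum. The left side is the value for
    the geometric sequence itself. *)
Lemma weighted_drops_ge (w A : nat -> R) (r : R) m :
  (forall j, (j < m)%N -> w j.+1 <= w j) -> (forall j, A j <= A 0%N * r ^+ j) ->
  A 0%N * ((1 - r) * \sum_(j < m) w j * r ^+ j + w m * r ^+ m) <=
  \sum_(j < m) w j * (A j - A j.+1) + w m * A m.
Proof.
move=> wdec Ale.
rewrite (_ : _ * _ = \sum_(j < m) w j * (A 0%N * r ^+ j - A 0%N * r ^+ j.+1) + w m * (A 0%N * r ^+ m)).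
  rewrite (summation_by_parts w A) (summation_by_parts w (fun j => A 0%N * r ^+ j)) expr0 mulr1 lerB// ler_sum// => j _.
  by rewrite ler_wpM2l// subr_ge0 wdec.
rewrite mulrDr mulrCA; congr (_ + _); last by ring.
rewrite mulrA mulr_sumr; apply: eq_bigr => j _; rewrite exprS; ring.
Qed.

(* [gain_coef k] bounds from below the relative gain h exp (- (r + h)^2 / 2) / r of a chord of
   length 2r <= 2h(k+1)/5 with h <= 1/5: there r + h <= (k+6)/25, and exp (- y^2) >= 1 - y^2
   is used with y = (k+6)/100 and raised to the power 8.
   [cost_coef k] bounds from below the inverse of the measure of such a chord, which is at
   most 8/19 * 2(k+1)/25 by [normal_peak1_le], and at most 1. *)
Definition gain_coef (k : nat) : R :=
  if (k < 40)%N then 5 / k.+1%:R * (1 - ((k + 6)%:R / 100) ^+ 2) ^+ 8 else 0.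
Definition cost_coef (k : nat) : R := if (k < 29)%N then 148 / 5 / k.+1%:R else 1.

Lemma gain_coef_ge0 k : 0 <= gain_coef k.
Proof.
rewrite /gain_coef; case: ifP => // k40.
rewrite mulr_ge0 ?divr_ge0// exprn_ge0// subr_ge0 expr_le1 ?divr_ge0// ler_pdivrMr// mul1r.
by rewrite ler_nat (leq_trans (leq_add (ltnW k40) (leqnn 6))).
Qed.

Lemma gain_coef_dec k : gain_coef k.+1 <= gain_coef k.
Proof.
have [k40|k40] := ltnP k.+1 40; last first.
  by rewrite {1}/gain_coef ltnNge k40/= gain_coef_ge0.
rewrite /gain_coef k40 (ltnW k40).
have y1 : ((k.+1 + 6)%:R / 100 : R) ^+ 2 <= 1.
  rewrite expr_le1 ?divr_ge0// ler_pdivrMr// mul1r ler_nat.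
  by rewrite (leq_trans (leq_add (ltnW k40) (leqnn 6))).
have y2 : ((k + 6)%:R / 100 : R) ^+ 2 <= ((k.+1 + 6)%:R / 100) ^+ 2.
  by rewrite ler_pXn2r ?nnegrE ?divr_ge0// ler_pM2r ?invr_gt0// ler_nat leq_add2r.
rewrite ler_pM ?divr_ge0 ?exprn_ge0 ?subr_ge0//.
  by rewrite ler_pM2l// lef_pV2 ?posrE ?ltr0n// ler_nat.
by rewrite ler_pXn2r ?nnegrE ?subr_ge0 ?(le_trans y2)// lerB.
Qed.

Lemma cost_coef_dec k : cost_coef k.+1 <= cost_coef k.
Proof.
rewrite /cost_coef; have [k28|k28] := ltnP k.+1 29.
  rewrite (ltnW k28) ler_pM2l; last by rewrite divr_gt0.
  by rewrite lef_pV2 ?posrE ?ltr0n// ler_nat.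
case: ifP => // k29; rewrite ler_pdivlMr ?ltr0n// mul1r (@le_trans _ _ 29%:R)//; last lra.
by rewrite ler_nat.
Qed.

(** The value of L 6 / L 5 at which the two cases of the final argument part. [gain_sum_ge] calls
    for a large value, [cost_sum_ge] for one away from 1, where its right side would only be 1. *)
Local Notation rho := (122 / 125 : R).

Lemma geometric_sum_split (f : nat -> R) (r : R) m n :
  \sum_(j < m + n) f j * r ^+ j =
  \sum_(i < m) f i * r ^+ i + r ^+ m * \sum_(j < n) f (m + j)%N * r ^+ j.
Proof.
rewrite big_split_ord mulr_sumr /=; congr (_ + _); apply: eq_bigr => j _.
by rewrite exprD mulrCA.
Qed.

(* 177 / 200 <= rho ^+ 5: the sums below are evaluated by blocks of five terms, as in Horner's
   scheme, to keep the rational numbers small. *)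
Lemma block_sum_ge (f : nat -> R) (a n : nat) (q t u : R) :
  q <= \sum_(i < 5) f (a + i)%N * rho ^+ i -> t <= \sum_(j < n) f (a + 5 + j)%N * rho ^+ j ->
  0 <= t -> u <= q + 177 / 200 * t -> u <= \sum_(j < 5 + n) f (a + j)%N * rho ^+ j.
Proof.
move=> qS tS t0 /le_trans; apply; rewrite (geometric_sum_split (fun j => f (a + j)%N)) lerD//.
under eq_bigr do rewrite addnA.
by apply: ler_pM; [lra|exact: t0|lra|exact: tS].
Qed.

Ltac five_terms :=
  rewrite 5!big_ord_recr big_ord0 /= /gain_coef /cost_coef -!plusE /=; lra.

(** The left side is the sum of rho^-i for i = 1, ..., 5, which is (rho^-5 - 1) / (1 - rho). With S
    the right side, the inequality reads rho^-5 <= 1 + (1 - rho) S: the gain makes up for a decay by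
    rho in each of the five steps from L 0 to L 5. *)
Lemma gain_sum_ge : 125 / 122 + (125 / 122) ^+ 2 + (125 / 122) ^+ 3 + (125 / 122) ^+ 4 + (125 / 122) ^+ 5 <=
  \sum_(j < 35) gain_coef (5 + j) * rho ^+ j.
Proof.
have b5 : 2 + 715 / 1000 <= \sum_(i < 5) gain_coef (5 + i) * rho ^+ i by five_terms.
have b10 : 1 + 438 / 1000 <= \sum_(i < 5) gain_coef (10 + i) * rho ^+ i by five_terms.
have b15 : 869 / 1000 <= \sum_(i < 5) gain_coef (15 + i) * rho ^+ i by five_terms.
have b20 : 546 / 1000 <= \sum_(i < 5) gain_coef (20 + i) * rho ^+ i by five_terms.
have b25 : 342 / 1000 <= \sum_(i < 5) gain_coef (25 + i) * rho ^+ i by five_terms.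
have b30 : 210 / 1000 <= \sum_(i < 5) gain_coef (30 + i) * rho ^+ i by five_terms.
have b35 : 124 / 1000 <= \sum_(i < 5) gain_coef (35 + i) * rho ^+ i by five_terms.
have s30 : 319 / 1000 <= \sum_(j < 10) gain_coef (30 + j) * rho ^+ j.
  by apply: (block_sum_ge b30 b35); clear; lra.
have s25 : 624 / 1000 <= \sum_(j < 15) gain_coef (25 + j) * rho ^+ j.
  by apply: (block_sum_ge b25 s30); clear; lra.
have s20 : 1 + 98 / 1000 <= \sum_(j < 20) gain_coef (20 + j) * rho ^+ j.
  by apply: (block_sum_ge b20 s25); clear; lra.
have s15 : 1 + 840 / 1000 <= \sum_(j < 25) gain_coef (15 + j) * rho ^+ j.
  by apply: (block_sum_ge b15 s20); clear; lra.
have s10 : 3 + 66 / 1000 <= \sum_(j < 30) gain_coef (10 + j) * rho ^+ j.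
  by apply: (block_sum_ge b10 s15); clear; lra.
have s5 : 5 + 428 / 1000 <= \sum_(j < 35) gain_coef (5 + j) * rho ^+ j.
  by apply: (block_sum_ge b5 s10); clear; lra.
by apply: le_trans s5; clear; lra.
Qed.

(** Write G for (1 - rho) times the gain sum and D for the last bracket. If L 0 - L 5 > G L 5 and
    148/25 (L 0 - L 5) + D L 5 <= 1 <= 2 L 0, then ((148/25 - 2) G + D - 2) L 5 < 0, which the
    inequality excludes. The number 148/25 is [cost_coef 4], the least weight of a lost chord. *)
Lemma cost_sum_ge :
  2 <= (148 / 25 - 2) * ((1 - rho) * \sum_(j < 35) gain_coef (5 + j) * rho ^+ j) +
       ((1 - rho) * \sum_(j < 35) cost_coef (5 + j) * rho ^+ j + rho ^+ 35).
Proof.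
have b5 : 18 + 328 / 1000 <= \sum_(i < 5) cost_coef (5 + i) * rho ^+ i by five_terms.
have b10 : 11 + 23 / 1000 <= \sum_(i < 5) cost_coef (10 + i) * rho ^+ i by five_terms.
have b15 : 7 + 907 / 1000 <= \sum_(i < 5) cost_coef (15 + i) * rho ^+ i by five_terms.
have b20 : 6 + 169 / 1000 <= \sum_(i < 5) cost_coef (20 + i) * rho ^+ i by five_terms.
have b25 : 5 + 71 / 1000 <= \sum_(i < 5) cost_coef (25 + i) * rho ^+ i by five_terms.
have b30 : 4 + 765 / 1000 <= \sum_(i < 5) cost_coef (30 + i) * rho ^+ i by five_terms.
have b35 : 4 + 765 / 1000 <= \sum_(i < 5) cost_coef (35 + i) * rho ^+ i by five_terms.
have s30 : 8 + 982 / 1000 <= \sum_(j < 10) cost_coef (30 + j) * rho ^+ j.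
  by apply: (block_sum_ge b30 b35); clear; lra.
have s25 : 13 + 20 / 1000 <= \sum_(j < 15) cost_coef (25 + j) * rho ^+ j.
  by apply: (block_sum_ge b25 s30); clear; lra.
have s20 : 17 + 691 / 1000 <= \sum_(j < 20) cost_coef (20 + j) * rho ^+ j.
  by apply: (block_sum_ge b20 s25); clear; lra.
have s15 : 23 + 563 / 1000 <= \sum_(j < 25) cost_coef (15 + j) * rho ^+ j.
  by apply: (block_sum_ge b15 s20); clear; lra.
have s10 : 31 + 876 / 1000 <= \sum_(j < 30) cost_coef (10 + j) * rho ^+ j.
  by apply: (block_sum_ge b10 s15); clear; lra.
have s5 : 46 + 538 / 1000 <= \sum_(j < 35) cost_coef (5 + j) * rho ^+ j.
  by apply: (block_sum_ge b5 s10); clear; lra.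
have r35 : 425 / 1000 <= rho ^+ 35.
  apply: (@le_trans _ _ ((177 / 200) ^+ 7)); first by clear; lra.
  by rewrite (exprM rho 5 7); apply: lerXn2r; rewrite ?nnegrE; clear; lra.
have := gain_sum_ge; move: s5 r35; clear.
move: (\sum_(j < 35) gain_coef (5 + j) * _) (\sum_(j < 35) _) (rho ^+ 35) => G C r hC hr hG.
lra.
Qed.

(** Log-concavity makes the ratios of consecutive terms nonincreasing while they are positive; once
    L reaches 0, monotonicity keeps it there. *)
Lemma log_concave_ratio (L : nat -> R) (a : nat) (r : R) :
  (forall k, 0 <= L k) -> (forall k, L k.+1 <= L k) -> (forall k, L k * L k.+2 <= L k.+1 ^+ 2) ->
  0 <= r -> L a.+1 <= L a * r -> forall j, L (a + j)%N <= L a * r ^+ j.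
Proof.
move=> L0 Ldec Llc r0 La.
have step k : L (a + k).+1 <= L (a + k)%N * r.
  elim: k => [|k IH]; first by rewrite addn0.
  have [Lk0|Lk0] := leP (L (a + k)%N) 0.
    have z i : (a + k <= i)%N -> L i = 0.
      move=> ki; apply/eqP; rewrite eq_le L0 andbT (le_trans _ Lk0)//.
      elim: i ki => [|i IHi]; first by rewrite leqn0 => /eqP ->.
      by rewrite leq_eqVlt => /predU1P[->//|/IHi]; exact: le_trans.
    rewrite addnS !z ?mul0r// ltnW//; exact: leqnSn.
  rewrite addnS -(ler_pM2l Lk0) (le_trans (Llc _))// mulrCA expr2.
  by rewrite ler_wpM2l.
elim=> [|j IHj]; first by rewrite addn0 mulr1.
by rewrite addnS exprSr mulrA (le_trans (step j))// ler_wpM2r.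
Qed.

(* If L 6 > rho * L 5, log-concavity propagates the ratio r = L 6 / L 5 backwards, so that L 0 is
   at most r^-5 * L 5, which the gain compensates. Otherwise L decays geometrically beyond 5,
   and a failure of the conclusion would make the cost exceed 1 because L 0 >= 1/2. *)
Lemma log_concave_drop_bound (L : nat -> R) :
  (forall k, 0 <= L k) -> (forall k, L k.+1 <= L k) -> (forall k, L k * L k.+2 <= L k.+1 ^+ 2) ->
  2^-1 <= L 0%N ->
  \sum_(k < 40) cost_coef k * (L k - L k.+1) + L 40%N <= 1 ->
  L 0%N <= L 5 + \sum_(j < 35) gain_coef (5 + j) * (L (5 + j)%N - L (5 + j).+1).
Proof.
move=> L0 Ldec Llc Lhalf cost.
set S := \sum_(j < 35) gain_coef (5 + j) * rho ^+ j.
have S_ge : _ <= S := gain_sum_ge.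
have r01 : 0 <= rho by lra.
have gain_ge (r : R) : (forall j, L (5 + j)%N <= L 5 * r ^+ j) ->
    L 5 * ((1 - r) * \sum_(j < 35) gain_coef (5 + j) * r ^+ j) <=
    \sum_(j < 35) gain_coef (5 + j) * (L (5 + j)%N - L (5 + j).+1).
  move=> Lr; have := @weighted_drops_ge (fun j => gain_coef (5 + j)) (fun j => L (5 + j)%N) r 35.
  rewrite /= addn0 (_ : gain_coef (5 + 35) = 0)// !mul0r !addr0; apply => //.
  by move=> j _; rewrite addnS gain_coef_dec.
have [case2|case1] := leP (L 6) (L 5 * rho).
  have Lr : forall j, L (5 + j)%N <= L 5 * rho ^+ j by exact: log_concave_ratio.
  have G := gain_ge _ Lr.
  rewrite leNgt; apply/negP => bad.
  have D : L 5 * ((1 - rho) * \sum_(j < 35) cost_coef (5 + j) * rho ^+ j + rho ^+ 35) <=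
      \sum_(j < 35) cost_coef (5 + j) * (L (5 + j)%N - L (5 + j).+1) + L 40%N.
    have := @weighted_drops_ge (fun j => cost_coef (5 + j)) (fun j => L (5 + j)%N) rho 35.
    rewrite /= addn0 (_ : cost_coef (5 + 35) = 1)// !mul1r; apply => //.
    by move=> j _; rewrite addnS cost_coef_dec.
  have first5 : 148 / 25 * (L 0%N - L 5) <= \sum_(k < 5) cost_coef k * (L k - L k.+1).
    rewrite !big_ord_recr big_ord0 /=.
    have ce k : (k < 5)%N -> 148 / 25 <= cost_coef k.
      move=> k5; rewrite /cost_coef (leq_trans k5)// ler_pdivlMr ?ltr0n//.
      have : (k.+1%:R : R) <= 5%:R by rewrite ler_nat.
      by move: (k.+1%:R : R) => x; lra.
    have cd k : (k < 5)%N -> 148 / 25 * (L k - L k.+1) <= cost_coef k * (L k - L k.+1).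
      by move=> k5; rewrite ler_wpM2r ?subr_ge0 ?ce.
    have := (cd 0 isT, cd 1 isT, cd 2 isT, cd 3 isT, cd 4 isT)%N.
    by case=> -[] [] [] c0 c1 c2 c3 c4; lra.
  have split_cost : \sum_(k < 40) cost_coef k * (L k - L k.+1) =
      \sum_(k < 5) cost_coef k * (L k - L k.+1) +
      \sum_(j < 35) cost_coef (5 + j) * (L (5 + j)%N - L (5 + j).+1).
    by rewrite (@big_split_ord _ _ _ 5 35).
  have := cost_sum_ge; rewrite -/S.
  move: D first5 G bad cost; rewrite split_cost.
  set D := _ + rho ^+ 35; set G := (1 - rho) * S.
  set g := \sum_(_ < _) gain_coef _ * _; set c1 := \sum_(_ < 5) _; set c2 := \sum_(_ < 35) _.
  move=> hD h5 hG bad cost num.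
  have := L0 5; move: (L 5) (L 0%N) (L 40%N) Lhalf hD h5 hG bad cost => x y z yh hD h5 hG bad cost x0.
  have : 0 <= x * ((148 / 25 - 2) * G + D - 2) by rewrite mulr_ge0//; lra.
  nra.
set x := L 5 in case1 *.
have x0 : 0 < x.
  rewrite lt0r L0 andbT; apply/eqP => x0; move: case1; rewrite x0 mul0r ltNge.
  by rewrite -x0 Ldec.
pose r := L 6 / x.
have r_gt : rho < r by rewrite ltr_pdivlMr// mulrC.
have r_le : r <= 1 by rewrite ler_pdivrMr// mul1r Ldec.
have L6 : L 6 = x * r by rewrite mulrC divfK// gt_eqF.
have r0 : 0 < r by lra.
have Lr : forall j, L (5 + j)%N <= x * r ^+ j.
  by apply: log_concave_ratio => //; [exact: ltW|rewrite L6].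
have back k : 0 < L k.+1 -> L k.+1 * r <= L k.+2 -> L k * r <= L k.+1.
  move=> p h; rewrite -(ler_pM2r p) -mulrA (mulrC r) -expr2 (le_trans _ (Llc k))//.
  by rewrite ler_wpM2l.
have p4 : 0 < L 4 := lt_le_trans x0 (Ldec 4).
have p3 : 0 < L 3 := lt_le_trans p4 (Ldec 3).
have p2 : 0 < L 2 := lt_le_trans p3 (Ldec 2).
have p1 : 0 < L 1 := lt_le_trans p2 (Ldec 1).
have b4 : L 4 * r <= L 5 by apply: back => //; rewrite L6.
have b3 := back _ p4 b4; have b2 := back _ p3 b3; have b1 := back _ p2 b2.
have b0 := back _ p1 b1.
have chain k m : L k * r <= L k.+1 -> L k * r ^+ m.+1 <= L k.+1 * r ^+ m.
  by move=> h; rewrite exprS mulrA ler_wpM2r ?exprn_ge0 ?(ltW r0).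
have x_ge : L 0%N * r ^+ 5 <= x.
  apply: le_trans (chain 0%N 4 b0) _; apply: le_trans (chain 1%N 3 b1) _.
  by apply: le_trans (chain 2%N 2 b2) _; apply: le_trans (chain 3%N 1 b3) _.
have Sr : S <= \sum_(j < 35) gain_coef (5 + j) * r ^+ j.
  apply: ler_sum => j _; rewrite ler_wpM2l ?gain_coef_ge0//.
  by apply: lerXn2r; rewrite ?nnegrE//; exact: ltW.
apply: le_trans _ (lerD (lexx x) (gain_ge _ Lr)).
move: Sr; set S' := \sum_(_ < _) _ => Sr.
rewrite -(ler_pM2r (exprn_gt0 5 r0)) (le_trans x_ge)// -[leLHS]mulr1 -[x in x + _]mulr1 -mulrDr.
rewrite -mulrA ler_wpM2l ?(ltW x0)//.
have rv : r^-1 <= 125 / 122 by rewrite -[leLHS]div1r ler_pdivrMr//; lra.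
have rvX k : r^-1 ^+ k <= (125 / 122) ^+ k.
  by apply: lerXn2r; rewrite ?nnegrE ?invr_ge0 ?(ltW r0)// divr_ge0.
have S'_ge : r^-1 + r^-1 ^+ 2 + r^-1 ^+ 3 + r^-1 ^+ 4 + r^-1 ^+ 5 <= S'.
  by apply: le_trans _ (le_trans S_ge Sr); rewrite !lerD.
have : (1 - r) * (r ^+ 5 * (r^-1 + r^-1 ^+ 2 + r^-1 ^+ 3 + r^-1 ^+ 4 + r^-1 ^+ 5)) <=
    (1 - r) * (r ^+ 5 * S').
  by rewrite !ler_wpM2l ?exprn_ge0 ?subr_ge0 ?(ltW r0).
(* A finite geometric sum. It yields 1 <= (1 + (1 - r) S') r^5, which is what remains of the claim
   after division by [x]. *)
rewrite (_ : (1 - r) * (r ^+ 5 * _) = 1 - r ^+ 5); last by field; rewrite gt_eqF.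
by move=> h; rewrite mulrDl mul1r; lra.
Qed.

End log_concave_sequences.

(** * Loss and gain on a single chord *)

Section chords_of_body.
Context {R : realType}.
Local Notation N := (@normal_prob R 0 1).

(** Squaring sin (pi / 4) <= pi / 4, where the sine has square 1/2. *)
Lemma sqr_pi_ge8 : 8 <= (pi : R) ^+ 2.
Proof.
have sle (x : R) : 0 <= x -> sin x <= x.
  rewrite le_eqVlt => /predU1P[<-|x0]; first by rewrite sin0.
  have [c _ e] : exists2 c, c \in `]0, x[%R & sin x - sin 0 = cos c * (x - 0).
    apply: MVT => //; last by apply: continuous_subspaceT => y; exact: continuous_sin.
  rewrite sin0 !subr0 in e; rewrite e ler_piMl ?cos_le1//; exact: ltW.
have s2 : sin (pi / 4 : R) ^+ 2 = 2^-1.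
  have := cos_pihalf R; rewrite (_ : pi / 2 = pi / 4 *+ 2); last by rewrite -mulr_natr; field.
  by rewrite cos_mulr2n cos2sin2 => h; lra.
have p0 : 0 <= pi / 4 :> R by rewrite divr_ge0// pi_ge0.
have s0 : 0 <= sin (pi / 4 : R).
  by apply: sin_ge0_pi; rewrite p0/= ler_pdivrMr// ler_peMr ?pi_ge0// ler1n.
have : sin (pi / 4 : R) ^+ 2 <= (pi / 4) ^+ 2.
  by rewrite ler_pXn2r ?nnegrE// sle.
rewrite s2 expr_div_n ler_pdivlMr ?exprn_gt0//; move=> h; lra.
Qed.

(** The peak is 1 / sqrt (2 pi) and (2 pi)^2 >= 32; the fraction 8/19 lies just above 32^(-1/4). *)
Lemma normal_peak1_le : normal_peak 1 <= 8 / 19 :> R.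
Proof.
rewrite /normal_peak expr1n mul1r.
have p2 : 5 <= pi *+ 2 :> R.
  have := sqr_pi_ge8; have := pi_gt0 R; rewrite -mulr_natr; move: (pi : R) => p p0 p8; nra.
have s_ge : 19 / 8 <= Num.sqrt (pi *+ 2 : R).
  have q : (19 / 8) ^+ 4 <= (pi *+ 2 : R) ^+ 2.
    have := sqr_pi_ge8; rewrite -mulr_natr exprMn => h.
    by have : (19 / 8 : R) ^+ 4 <= 32; [lra|lra].
  have q2 : (19 / 8) ^+ 2 <= (pi *+ 2 : R).
    rewrite -(@ler_pXn2r _ 2)// ?nnegrE ?exprn_ge0 ?divr_ge0//; last by lra.
    by rewrite -exprM.
  rewrite -[leLHS]ger0_norm ?divr_ge0// -sqrtr_sqr ler_sqrt//; lra.
by rewrite (_ : 8 / 19 = (19 / 8)^-1); [rewrite lef_pV2 ?posrE//; lra|field].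
Qed.

(** A step sequence has a single drop, at index [m.-1]. If that lies at or beyond [N], the boundary
    term accounts for it with weight [w N]; hence the minimum. *)
Lemma threshold_sum (w A : nat -> R) (F : R) (m N : nat) :
  (0 < m)%N -> (forall k, A k = if (k < m)%N then F else 0) ->
  \sum_(k < N) w k * (A k - A k.+1) + w N * A N = F * w (minn m.-1 N).
Proof.
move=> m0 AE; elim: N => [|N IH]; first by rewrite big_ord0 add0r AE m0 minn0 mulrC.
rewrite big_ord_recr /=.
rewrite (_ : _ + _ = (\sum_(k < N) w k * (A k - A k.+1) + w N * A N) - (w N - w N.+1) * A N.+1); last by ring.
rewrite IH AE; case: ifP => [Nm|].
  have h : (N <= m.-1)%N by rewrite -ltnS prednK// ltnW.
  have h' : (N.+1 <= m.-1)%N by rewrite -ltnS prednK.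
  by rewrite (minn_idPr h) (minn_idPr h'); ring.
move/negbT; rewrite -leqNgt -(prednK m0) ltnS => h.
by rewrite (minn_idPl h) (minn_idPl (leqW h)) mulr0 subr0.
Qed.

Lemma convex_compact_interval (I : set R) : compact I -> I !=set0 ->
  (forall x y t, I x -> I y -> 0 <= t <= 1 -> I (t * x + (1 - t) * y)) ->
  exists a b, a <= b /\ I = `[a, b]%classic.
Proof.
move=> cI I0 convI.
have ci : {within I, continuous (@idfun R)}.
  by apply: continuous_subspaceT => x; exact: cvg_id.
have [b /set_mem Ib bmax] := compact_EVT_max I0 cI ci.
have [a /set_mem Ia amin] := compact_EVT_min I0 cI ci.
have ab : a <= b by exact: (amin _ (mem_set Ib)).
exists a, b; split => //; apply/seteqP; split => x /=; rewrite in_itv/=.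
  by move=> Ix; rewrite (amin _ (mem_set Ix)) (bmax _ (mem_set Ix)).
move=> /andP[ax xb]; have [->//|axn] := eqVneq x a.
have ba : 0 < b - a by rewrite subr_gt0 (lt_le_trans _ xb)// lt_neqAle eq_sym axn.
rewrite (_ : x = (b - x) / (b - a) * a + (1 - (b - x) / (b - a)) * b).
  apply: convI => //; rewrite divr_ge0 ?subr_ge0 ?(ltW ba)//=.
  by rewrite ler_pdivrMr// mul1r lerD2l lerN2.
by field; rewrite gt_eqF.
Qed.

Variables (I : set R) (h : R).
Hypotheses (cI : compact I)
  (convI : forall x y t, I x -> I y -> 0 <= t <= 1 -> I (t * x + (1 - t) * y))
  (h0 : 0 < h) (h5 : h <= 5^-1).

Let tau (k : nat) : R := 2 * h * k%:R / 5.
Let long (d : R) := [set t | I t /\ exists s, I s /\ I (s + d)].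
Let F (k : nat) : R := line_gauss (long (tau k)).

(** [long (tau k)] is all of [I] or empty according to whether the length of [I] reaches [tau k], so
    [F] is a step sequence, and [m] is the first index with [tau m] above the length. *)
Lemma chord_threshold : I = set0 \/ exists a b m, [/\ a <= b, I = `[a, b]%classic, (0 < m)%N,
  forall k, (tau k <= b - a) = (k < m)%N & forall k, F k = if (k < m)%N then line_gauss I else 0].
Proof.
have [I0|I0] := pselect (I !=set0); last first.
  by left; apply: contrapT => H; apply: I0; apply/set0P/eqP.
have [a [b [ab IE]]] := convex_compact_interval cI I0 convI; right.
pose m := (Num.truncn ((b - a) * 5 / (2 * h))).+1.
have h2 : 0 < 2 * h by rewrite mulr_gt0.
have x0 : 0 <= (b - a) * 5 / (2 * h) by rewrite divr_ge0 ?mulr_ge0 ?subr_ge0// ltW.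
have tauE k : (tau k <= b - a) = (k < m)%N.
  rewrite /tau ler_pdivrMr//.
  rewrite /m ltnS truncn_ge_nat// ler_pdivlMr// mulrC.
  by apply/idP/idP; lra.
exists a, b, m; split => // k; rewrite /F -tauE; case: ifP => [kl|/negbT kl].
  congr line_gauss; apply/seteqP; split => t; [by case|move=> It; split => //].
  exists a; rewrite IE /= !in_itv/= lexx ab/=; split => //.
  have : 0 <= tau k by rewrite /tau divr_ge0 ?mulr_ge0// ltW.
  by lra.
rewrite (_ : long _ = set0) ?line_gauss_set0// -subset0 => t [_ [s []]].
rewrite IE /= !in_itv/= => /andP[s1 s2] /andP[s3 s4]; move: kl; rewrite -ltNge; lra.
Qed.

(** By [threshold_sum] the left side is [line_gauss I] times the cost coefficient at [minn m.-1 40].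
    As the chord is shorter than [tau m], its measure is at most the inverse of that coefficient. *)
Lemma chord_cost : \sum_(k < 40) cost_coef k * (F k - F k.+1) + F 40%N <= 1.
Proof.
have F01 : 0 <= line_gauss I <= 1.
  by apply: line_gauss01; exact: compact_measurable.
case: chord_threshold => [I0|[a [b [m [ab IE m0 tauE FE]]]]].
  have F0 k : F k = 0.
    by rewrite /F (_ : long _ = set0) ?line_gauss_set0// -subset0 => t [+ _]; rewrite I0.
  by rewrite F0 addr0 big1// => k _; rewrite !F0 subrr mulr0.
have := threshold_sum cost_coef 40 m0 FE; rewrite {2}/cost_coef/= mul1r => ->.
case/andP: F01 => f0 f1; rewrite /cost_coef; case: ifP => [k29|_]; last by rewrite mulr1.
have mE : minn m.-1 40 = m.-1.
  by apply/minn_idPl; move: k29; rewrite gtn_min => /orP[/ltnW/leq_trans->|].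
move: k29; rewrite mE (prednK m0) => k29.
have : ~~ (tau m <= b - a) by rewrite tauE ltnn.
rewrite -ltNge => Lt.
have Fle : line_gauss I <= 8 / 19 * (2 / 25 * m%:R).
  rewrite {1}IE (le_trans (line_gauss_le_length ab))// ler_pM ?normal_peak_ge0 ?subr_ge0//.
    exact: normal_peak1_le.
  rewrite (le_trans (ltW Lt))// /tau.
  have : 0 <= m%:R :> R by []; move: (m%:R : R) => x x0.
  have := ler_wpM2r x0 h5; lra.
have mp : 0 < m%:R :> R by rewrite ltr0n.
rewrite mulrA ler_pdivrMr// mul1r; move: Fle mp; move: (m%:R : R) => x; lra.
Qed.

(** Since [tau 5] is 2h, the left side vanishes for m <= 5. Otherwise it is [line_gauss I] times one
    plus the gain coefficient at min (m - 1, 40), and [B] contains the chord lengthened by h at both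
    ends. The coefficient 0 at index 40 serves all longer chords. *)
Lemma chord_gain (B : set R) : measurable B ->
  (forall s t, I s -> I (s + 2 * h) -> s - h <= t <= s + 3 * h -> B t) ->
  F 5 + \sum_(j < 35) gain_coef (5 + j) * (F (5 + j)%N - F (5 + j).+1) <= line_gauss B.
Proof.
move=> mB HB.
have B0 : 0 <= line_gauss B by case/andP: (line_gauss01 mB).
have zero m : (m <= 5)%N -> (forall k, F k = if (k < m)%N then line_gauss I else 0) ->
   F 5 + \sum_(j < 35) gain_coef (5 + j) * (F (5 + j)%N - F (5 + j).+1) <= line_gauss B.
  move=> m5 FE.
  have z k : (5 <= k)%N -> F k = 0 by move=> k5; rewrite FE ltnNge (leq_trans m5 k5).
  rewrite z// add0r big1 => [//|j _].
  by rewrite (z (5 + j)%N (leq_addr _ _)) (z (5 + j).+1 (leqW (leq_addr _ _))) subrr mulr0.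
case: chord_threshold => [I0|[a [b [m [ab IE m0 tauE FE]]]]].
  apply: (zero 0%N) => // k.
  by rewrite /F (_ : long _ = set0) ?line_gauss_set0// -subset0 => t [+ _]; rewrite I0.
have [m5|m5] := leqP m 5; first exact: (zero m).
have L5 : 2 * h <= b - a.
  have : tau 5 <= b - a by rewrite tauE.
  by rewrite /tau mulfK.
have FE' j : F (5 + j)%N = if (j < m - 5)%N then line_gauss I else 0.
  by rewrite FE ltn_subRL.
have m5' : (0 < m - 5)%N by rewrite subn_gt0.
have := threshold_sum (fun j => gain_coef (5 + j)) 35 m5' FE'.
rewrite {2}/gain_coef/= mul0r addr0 => e.
rewrite (eq_bigr (fun j : 'I_35 => gain_coef (5 + j) * (F (5 + j)%N - F (5 + j.+1)%N))).
  2: by move=> j _; rewrite addnS.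
rewrite e FE m5.
pose c := (a + b) / 2; pose r := (b - a) / 2.
have r0 : 0 < r by rewrite divr_gt0// (lt_le_trans _ L5)// mulr_gt0.
have cr : c - r = a by rewrite /c /r; field.
have cr' : c + r = b by rewrite /c /r; field.
have IE' : I = `[(c - r), (c + r)]%classic.
  by rewrite IE cr cr'.
have sub : `[(c - (r + h)), (c + (r + h))]%classic `<=` B.
  move=> t /=; rewrite in_itv/= opprD !addrA cr cr' => /andP[t1 t2].
  have Iab x : a <= x <= b -> I x by move=> xab; rewrite IE /= in_itv.
  have hp : 0 < h := h0.
  (* The base points a, t - h and b - 2h cover the left end, the middle and the right end of
     [a - h, b + h]. *)
  have [ta|ta] := leP t (a + h).
    by apply: (HB a); [apply: Iab|apply: Iab|]; apply/andP; split; lra.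
  have [tb|tb] := leP t (b - h).
    by apply: (HB (t - h)); [apply: Iab|apply: Iab|]; apply/andP; split; lra.
  by apply: (HB (b - 2 * h)); [apply: Iab|apply: Iab|]; apply/andP; split; lra.
apply: le_trans (le_line_gauss _ mB sub) => //.
have := line_gauss_gain c r0 (ltW h0); rewrite -IE'; apply: le_trans.
rewrite mulrDl mul1r lerD2l mulrC ler_wpM2r//.
  by case/andP: (@line_gauss01 R I (compact_measurable cI)).
rewrite /gain_coef; case: ifP => [k40|_]; last first.
  by apply: divr_ge0; [apply: mulr_ge0; [exact: ltW|exact: expR_ge0]|exact: ltW].
have mE : (5 + minn (m - 5).-1 35 = m.-1)%N.
  have : (minn (m - 5).-1 35 < 35)%N by rewrite -(ltn_add2l 5).
  rewrite gtn_min ltnn orbF => h35; rewrite (minn_idPl (ltnW h35)).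
  by rewrite -[in RHS](subnKC (ltnW m5)) -[in RHS](prednK m5') addnS.
have : ~~ (tau m <= b - a) by rewrite tauE ltnn.
rewrite mE in k40 *; rewrite -ltNge /tau => Lt.
have xE : (m.-1 + 6)%:R = m%:R + 5 :> R by rewrite -natrD -[in RHS](prednK m0) addSnnS.
have x40 : m%:R <= 40%:R :> R by rewrite ler_nat -(prednK m0).
have x1 : 0 < m%:R :> R by rewrite ltr0n.
rewrite xE (prednK m0); move: (m%:R : R) x1 x40 Lt => x x1 x40 Lt.
have hp : 0 < h := h0.
have h5' : h <= 5^-1 := h5.
have rx : r <= h * x / 5 by rewrite /r; lra.
have y1 : ((x + 5) / 100) ^+ 2 <= 1.
  by rewrite expr_le1//; lra.
rewrite [leRHS]mulrAC; apply: ler_pM.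
- by apply: divr_ge0 => //; exact: ltW.
- by rewrite exprn_ge0// subr_ge0.
- by rewrite ler_pdivrMr// mulrAC ler_pdivlMr//; lra.
have e1 : 1 - ((x + 5) / 100) ^+ 2 <= expR (- ((x + 5) / 100) ^+ 2) := expR_ge1Dx _.
(* With y = (x + 5) / 100 one has r + h <= 4y, so that (r + h)^2 / 2 <= 8 y^2: hence the eighth
   power. *)
apply: (@le_trans _ _ (expR (- ((x + 5) / 100) ^+ 2) ^+ 8)).
  by apply: lerXn2r => //; rewrite nnegrE ?expR_ge0// subr_ge0.
rewrite -expRM_natl ler_expR mulrN lerN2.
have rh : r + h <= (x + 5) / 25.
  apply: (@le_trans _ _ (h * (x + 5) / 5)); first lra.
  by rewrite ler_pdivrMr// (le_trans (ler_wpM2r _ h5))//; lra.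
have rh2 : (r + h) ^+ 2 <= ((x + 5) / 25) ^+ 2.
  by rewrite ler_pXn2r ?nnegrE//; lra.
move: rh2; rewrite !expr_div_n; lra.
Qed.

End chords_of_body.

(** * The set K*u, and its measure when u lies on the first axis *)

Section banaszczyk_step.
Context {R : realType}.
Local Notation N := (@normal_prob R 0 1).
Local Notation RT := (measurableTypeR R).

Lemma Rintegral_weighted_drops d (T : measurableType d) (P : probability T R) (w : nat -> R)
    (f : nat -> T -> R) (m : nat) : (forall k, P.-integrable setT (EFin \o f k)) ->
  P.-integrable setT (EFin \o (fun x => \sum_(k < m) w k * (f k x - f k.+1 x))) /\
  Rintegral P setT (fun x => \sum_(k < m) w k * (f k x - f k.+1 x)) =
  \sum_(k < m) w k * (Rintegral P setT (f k) - Rintegral P setT (f k.+1)).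
Proof.
move=> intf; elim: m => [|m [IHi IHe]].
  rewrite big_ord0 (_ : (fun x => _) = cst 0); last by apply/funext => x; rewrite big_ord0.
  split; first exact: finite_measure_integrable_cst.
  by rewrite Rintegral_cst// mul0r.
have idiff : P.-integrable setT (EFin \o (fun x => f m x - f m.+1 x)).
  exact: (integrableB measurableT (intf m) (intf m.+1)).
have iw : P.-integrable setT (EFin \o (fun x => w m * (f m x - f m.+1 x))).
  exact: (integrableZl measurableT (w m) idiff).
rewrite (_ : (fun x => _) = (fun x => \sum_(k < m) w k * (f k x - f k.+1 x) +
    w m * (f m x - f m.+1 x))); last by apply/funext => x; rewrite big_ord_recr.
split; first exact: (integrableD measurableT IHi iw).
rewrite RintegralD// IHe big_ord_recr /=; congr (_ + _).
by rewrite RintegralZl// RintegralB.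
Qed.

Lemma Rintegral_probability_cst d (T : measurableType d) (P : probability T R) (c : R) :
  Rintegral P setT (fun=> c) = c.
Proof.
refine (etrans (Rintegral_cst P measurableT c) _).
exact: etrans (congr1 (fun x => c * fine x) (probability_setT P)) (mulr1 c).
Qed.

(** K*u as the Minkowski sum of the intersection of K and K - 2u with the segment [- u, 3u], a form
    in which convexity and compactness are inherited from K. *)
Definition bstar n (K : set 'rV[R]_n) (u : 'rV[R]_n) : set 'rV[R]_n :=
  [set z | exists w (t : R), [/\ K w, K (w + 2 *: u), -1 <= t <= 3 & z = w + t *: u]].

Lemma bstar_sub n (K : set 'rV[R]_n) u z : convex_rV K -> bstar K u z -> K (z - u) \/ K (z + u).
Proof.
move=> cK [w [t [Kw Kwu /andP[t1 t3] ->]]].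
have conv s : 0 <= s <= 2 -> K (w + s *: u).
  move=> /andP[s0 s2].
  have := cK _ _ (s / 2) Kwu Kw; rewrite divr_ge0// ler_pdivrMr// mul1r => /(_ isT s2).
  congr (K _); rewrite scalerDr scalerA divfK// scalerBl scale1r addrAC [_ + (w - _)]addrC subrK.
  by rewrite addrC.
have [t1'|t1'] := leP t 1.
  right; have -> : w + t *: u + u = w + (t + 1) *: u by rewrite scalerDl scale1r addrA.
  by apply: conv; apply/andP; split; lra.
left; have -> : w + t *: u - u = w + (t - 1) *: u by rewrite scalerBl scale1r addrA.
by apply: conv; apply/andP; split; lra.
Qed.

Lemma bstar_convex n (K : set 'rV[R]_n) u : convex_rV K -> convex_rV (bstar K u).
Proof.
move=> cK x y s [w1 [t1 [K1 K1u /andP[a1 b1] ->]]] [w2 [t2 [K2 K2u /andP[a2 b2] ->]]] s0 s1.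
exists (s *: w1 + (1 - s) *: w2), (s * t1 + (1 - s) * t2); split.
- exact: cK.
- have := cK _ _ s K1u K2u s0 s1; congr (K _).
  rewrite !scalerDr !scalerA addrACA; congr (_ + _).
  by rewrite -scalerDl -mulrDl subrKC mul1r.
- by apply/andP; split; nra.
- rewrite !scalerDr !scalerA addrACA; congr (_ + _).
  by rewrite -scalerDl.
Qed.

Lemma continuous_shift n (u : 'rV[R]_n) : continuous (fun w : 'rV[R]_n => w + u).
Proof. by move=> x; exact: (cvgD cvg_id (cvg_cst u)). Qed.

Lemma bstar_compact n (K : set 'rV[R]_n) u : compact K -> compact (bstar K u).
Proof.
move=> cK.
have cS : compact ((K `&` [set w | K (w + 2 *: u)]) `*` `[(-1 : R), 3]%classic).
  apply: compact_setX; last exact: segment_compact.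
  apply: compact_closedI => //.
  by apply: (closed_continuous_preimage (@continuous_shift n _)); exact: compact_closed_rV.
have cf : continuous (fun p : 'rV[R]_n * R => p.1 + p.2 *: u).
  move=> x.
  have c1 : continuous (@fst 'rV[R]_n R) by move=> y; exact: cvg_fst.
  have c2 : continuous (@snd 'rV[R]_n R) by move=> y; exact: cvg_snd.
  have c3 : (fun p : 'rV[R]_n * R => p.2 *: u) @ x --> x.2 *: u.
    refine (@cvgZr_tmp _ _ _ (nbhs x) _ (fun p : 'rV[R]_n * R => p.2) _ u _).
    exact: c2.
  exact: (cvgD (c1 x) c3).
rewrite (_ : bstar K u = (fun p : 'rV[R]_n * R => p.1 + p.2 *: u) @`
    ((K `&` [set w | K (w + 2 *: u)]) `*` `[(-1 : R), 3]%classic)).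
  exact: continuous_compact_image.
apply/seteqP; split => z.
  by move=> [w [t [Kw Kwu t13 ->]]]; exists (w, t) => //; split => //=; rewrite in_itv.
by move=> [[w t] [[/= Kw Kwu]]]; rewrite in_itv/= => t13 <-; exists w, t.
Qed.

(* The union of the chords of K in the direction of the first axis whose length is at least d. *)
Definition longpart n (K : set 'rV[R]_n.+1) (d : R) : set 'rV[R]_n.+1 :=
  [set v | K v /\ exists w, [/\ K w, K (w + d *: consr 1 0) & tailr w = tailr v]].

Lemma consr_tailr n (v : 'rV[R]_n.+1) : consr (v 0 ord0) (tailr v) = v.
Proof. exact: esym (consr_eta v). Qed.

Lemma consr_shift n (t d : R) (v : 'rV[R]_n) : consr t v + d *: consr 1 0 = consr (t + d) v.
Proof. by rewrite -consrZ -consrD mulr1 scaler0 addr0. Qed.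

Lemma longpart_compact n (K : set 'rV[R]_n.+1) d : compact K -> compact (longpart K d).
Proof.
move=> cK; have clK := compact_closed_rV cK.
pose S := (K `*` K) `&` [set p : 'rV[R]_n.+1 * 'rV[R]_n.+1 | K (p.1 + d *: consr 1 0)]
   `&` [set p | [set (0 : 'rV[R]_n)] (tailr p.1 - tailr p.2)].
have ctail (f : 'rV[R]_n.+1 * 'rV[R]_n.+1 -> 'rV[R]_n.+1) : continuous f ->
    continuous (fun p => tailr (f p)).
  by move=> cf x; apply: continuous_comp; [exact: cf|exact: continuous_tailr].
have cfst : continuous (@fst 'rV[R]_n.+1 'rV[R]_n.+1) by move=> x; exact: cvg_fst.
have csnd : continuous (@snd 'rV[R]_n.+1 'rV[R]_n.+1) by move=> x; exact: cvg_snd.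
have cS : compact S.
  apply: compact_closedI; first apply: compact_closedI.
  - exact: compact_setX.
  - apply: (closed_continuous_preimage _ clK) => x.
    exact: (cvgD (cfst x) (cvg_cst _)).
  - apply: (closed_continuous_preimage (U := 'rV[R]_n)); last first.
      by apply: compact_closed_rV; exact: compact_set1.
    by move=> x; exact: (cvgB (ctail _ cfst x) (ctail _ csnd x)).
rewrite (_ : longpart K d = snd @` S); first exact: continuous_compact_image.
apply/seteqP; split => v.
  move=> [Kv [w [Kw Kwd e]]]; exists (w, v) => //; split => //=.
  by rewrite e subrr.
move=> [[w v'] [[[/= Kw Kv] Kwd] /= e] <-]; split => //; exists w; split => //.
by apply/eqP; rewrite -subr_eq0; apply/eqP.
Qed.

Variables (n : nat) (K : set 'rV[R]_n.+1).
Hypotheses (cK : compact K) (convK : convex_rV K).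

(** Brings the chord to the form in which [chord_cost] and [chord_gain] are stated. *)
Lemma chord_longpart d v : chord (longpart K d) v =
  [set t | chord K v t /\ exists s, chord K v s /\ chord K v (s + d)].
Proof.
apply/seteqP; split => t; rewrite /chord /longpart /=.
  move=> [Kt [w [Kw Kwd e]]]; split => //; exists (w 0 ord0); rewrite tailr_consr in e.
  by move: Kw Kwd; rewrite -{1 2}(consr_tailr w) e consr_shift.
move=> [Kt [s [Ks Ksd]]]; split => //; exists (consr s v); split => //.
  by rewrite consr_shift.
by rewrite !tailr_consr.
Qed.

Lemma chord_compact v : compact (chord K v).
Proof.
pose S := K `&` [set w | [set v] (tailr w)].
have cS : compact S.
  apply: compact_closedI => //; apply: (closed_continuous_preimage (@continuous_tailr R n)).
  by apply: compact_closed_rV; exact: compact_set1.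
rewrite (_ : chord K v = (fun w : 'rV[R]_n.+1 => w 0 ord0) @` S).
  by apply: continuous_compact_image => //; exact: (@coord_continuous R 1 n.+1 0 ord0).
apply/seteqP; split => t.
  by move=> Kt; exists (consr t v); [split => //=; exact: tailr_consr|exact: consr0].
by move=> [w [Kw /= e] <-]; rewrite /chord /= -e consr_tailr.
Qed.

Lemma chord_convex v x y (t : R) : chord K v x -> chord K v y -> 0 <= t <= 1 ->
  chord K v (t * x + (1 - t) * y).
Proof.
rewrite /chord /= => Kx Ky /andP[t0 t1]; have := convK Kx Ky t0 t1; congr (K _).
by rewrite -!consrZ -consrD -scalerDl subrKC scale1r.
Qed.

Lemma longpart_gmeasurable d : gmeasurable (longpart K d).
Proof. by apply: compact_gmeasurable; exact: longpart_compact. Qed.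

Lemma convex_segment d v w : K w -> 0 <= d -> forall d', d <= d' -> K (w + d' *: v) ->
  K (w + d *: v).
Proof.
move=> Kw d0 d' dd Kd'; have [->|dn] := eqVneq d 0; first by rewrite scale0r addr0.
have d'0 : 0 < d' by rewrite (lt_le_trans _ dd)// lt0r dn.
have := convK Kd' Kw (t := d / d'); rewrite divr_ge0 ?(ltW d'0)// ler_pdivrMr// mul1r.
move=> /(_ isT dd); congr (K _).
rewrite scalerDr scalerA divfK ?gt_eqF// scalerBl scale1r addrAC [_ + (w - _)]addrC subrK.
by rewrite addrC.
Qed.

Lemma longpart0 : longpart K 0 = K.
Proof.
apply/seteqP; split => v; first by case.
by move=> Kv; split => //; exists v; rewrite scale0r addr0.
Qed.

Lemma longpart_mono d d' : 0 <= d -> d <= d' -> longpart K d' `<=` longpart K d.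
Proof.
move=> d0 dd v [Kv [w [Kw Kwd e]]]; split => //; exists w; split => //.
exact: (convex_segment Kw d0 dd).
Qed.

(** The chord length is a concave function of the position of the chord. Since the thresholds form
    an arithmetic progression, this is the hypothesis of [gmeas_midpoint] for three consecutive
    L_k. *)
Lemma longpart_midpoint d d' x y : longpart K d x -> longpart K d' y ->
  longpart K ((d + d') / 2) (2^-1 *: (x + y)).
Proof.
have half x' y' : K x' -> K y' -> K (2^-1 *: (x' + y')).
  move=> Kx Ky; have := convK Kx Ky (t := 2^-1).
  rewrite (_ : 1 - 2^-1 = 2^-1 :> R); last by field.
  by rewrite -scalerDr; apply; lra.
move=> [Kx [w [Kw Kwd e]]] [Ky [w' [Kw' Kwd' e']]]; split; first exact: half.
exists (2^-1 *: (w + w')); split; first exact: half.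
  have := half _ _ Kwd Kwd'; congr (K _).
  by rewrite addrACA -scalerDl scalerDr scalerA; congr (_ + _ *: _); rewrite mulrC.
have tD (u u' : 'rV[R]_n.+1) : tailr (2^-1 *: (u + u')) = 2^-1 *: (tailr u + tailr u').
  by apply/rowP => i; rewrite !mxE.
by rewrite !tD e e'.
Qed.

Variable a : R.
Hypotheses (a0 : a != 0) (a5 : `|a| <= 5^-1).
Let h := `|a|.
Let tau (k : nat) : R := 2 * h * k%:R / 5.
Let L (k : nat) := gmeas (longpart K (tau k)).
Let B := bstar K (consr a 0).

Lemma gmeas_bstar_axis : 2^-1 <= gmeas K -> gmeas K <= gmeas B.
Proof.
move=> Khalf.
have hp : 0 < h by rewrite normr_gt0.
have tau0 k : 0 <= tau k by rewrite /tau divr_ge0// mulr_ge0// mulr_ge0// ltW.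
have tau_le k : tau k <= tau k.+1.
  by rewrite /tau ler_pM2r// ler_pM2l ?mulr_gt0// ler_nat.
have L0E : L 0%N = gmeas K by rewrite /L /tau mulr0 mul0r longpart0.
pose f k (z : gspace n) := line_gauss (chord (longpart K (tau k)) (grow z)).
have mB : gmeasurable B by apply: compact_gmeasurable; exact: bstar_compact.
have mchord (A : set 'rV[R]_n.+1) v : compact A -> measurable (chord A v).
  move=> cA; apply: closed_measurable.
  apply: (closed_continuous_preimage (f := fun t => consr t v)); last exact: compact_closed_rV.
  by apply: continuous_consr; [move=> x; exact: cvg_id|exact: cst_continuous].
have int_chord (A : set 'rV[R]_n.+1) : compact A ->
    (gprob n).-integrable setT (EFin \o (fun z => line_gauss (chord A (grow z)))).
  move=> cA; apply: integrable01; last by move=> z; exact: line_gauss01 (mchord A _ cA).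
  have mA := measurable_indic_grow (compact_gmeasurable cA).
  (* The first coordinate is the one integrated out here, so the factors of [gspace n.+1] are
     swapped to fit [measurable_Rintegral_xsection]. *)
  have mF : measurable_fun setT
      (fun p : gspace n * RT => (\1_A (@grow R n.+1 (p.2, p.1)) : R)).
    exact: (@measurableT_comp _ _ _ _ _ _ (fun z : gspace n.+1 => (\1_A (grow z) : R)) setT
      (fun p : gspace n * RT => (p.2, p.1) : gspace n.+1) mA (measurable_fun_pair measurable_snd measurable_fst)).
  have := measurable_Rintegral_xsection N mF (fun p => indic01 A _).
  congr measurable_fun; apply/funext => z; apply: eq_Rintegral => t _ /=.
  by rewrite grow_cons !indicE; congr (_%:R); apply/idP/idP; rewrite !inE.
have intf k : (gprob n).-integrable setT (EFin \o f k).
  by apply: int_chord; exact: longpart_compact.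
have Lf k : L k = Rintegral (gprob n) setT (f k) by exact: gmeas_chord (longpart_gmeasurable _).
have FE k z : line_gauss [set t | chord K (grow z) t /\
    exists s, chord K (grow z) s /\ chord K (grow z) (s + 2 * h * k%:R / 5)] = f k z.
  by rewrite /f chord_longpart.
have cc (z : gspace n) : compact (chord K (grow z)) by exact: chord_compact.
have cv (z : gspace n) := @chord_convex (grow z).
have cost : \sum_(k < 40) cost_coef k * (L k - L k.+1) + L 40%N <= 1.
  have [ic ec] := Rintegral_weighted_drops cost_coef 40 intf.
  rewrite (eq_bigr (fun k : 'I_40 => cost_coef k * (Rintegral (gprob n) setT (f k) -
    Rintegral (gprob n) setT (f k.+1)))); last by move=> k _; rewrite !Lf.
  rewrite Lf -ec -RintegralD//; last exact: (intf 40%N).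
  have -> : 1 = Rintegral (gprob n) setT (fun=> 1 : R).
    by rewrite Rintegral_probability_cst.
  apply: le_Rintegral => //.
  - exact: (integrableD measurableT ic (intf 40%N)).
  - exact: finite_measure_integrable_cst.
  move=> z _; have := chord_cost (cc z) (cv z) hp a5.
  rewrite FE; under eq_bigr do rewrite !FE.
  by [].
have Lmid k : L k * L k.+2 <= L k.+1 ^+ 2.
  apply: gmeas_midpoint; try exact: longpart_gmeasurable.
  move=> x y Lx Ly; have := longpart_midpoint Lx Ly; congr (longpart K _ _).
  by rewrite /tau -!natr1; field.
have Lge0 k : 0 <= L k by case/andP: (gmeas01 (longpart_gmeasurable (tau k))).
have Ldec k : L k.+1 <= L k.
  by apply: le_gmeas; try exact: longpart_gmeasurable; exact: longpart_mono.
have Lh : 2^-1 <= L 0%N by rewrite L0E.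
rewrite -L0E; apply: (le_trans (log_concave_drop_bound Lge0 Ldec Lmid Lh cost)).
have [ic ec] := Rintegral_weighted_drops (fun j => gain_coef (5 + j)) 35 (fun j => intf (5 + j)%N).
rewrite (eq_bigr (fun j : 'I_35 => gain_coef (5 + j) * (Rintegral (gprob n) setT (f (5 + j)%N) -
  Rintegral (gprob n) setT (f (5 + j.+1)%N)))); last by move=> j _; rewrite !Lf addnS.
rewrite Lf -ec -RintegralD//; last exact: (intf 5).
rewrite gmeas_chord//.
apply: le_Rintegral => //.
- exact: (integrableD measurableT (intf 5) ic).
- by apply: int_chord; exact: bstar_compact.
move=> z _; have := chord_gain (cc z) (cv z) hp a5 (B := chord B (grow z)).
rewrite FE; under eq_bigr do rewrite !FE -addnS.
apply; first by apply: mchord; exact: bstar_compact.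
move=> s t Ks Ks2 /andP[st1 st2]; rewrite /chord /= /B /bstar /=.
have shiftE c d : consr c (grow z) + d *: consr a 0 = consr (c + d * a) (grow z).
  by rewrite -consrZ -consrD scaler0 addr0.
have [a_gt0|a_le0] := ltP 0 a.
  have ha : h = a by rewrite /h gtr0_norm.
  exists (consr s (grow z)), ((t - s) / a); rewrite !shiftE divfK ?subrKC//; split => //.
    by rewrite -ha.
  rewrite ler_pdivlMr// ler_pdivrMr// -ha; apply/andP; split; lra.
have ha : h = - a by rewrite /h ler0_norm.
have a_lt0 : a < 0 by rewrite lt_neqAle a0.
(* For a < 0 the vector u points down the axis: the segment from w to w + 2u starts at the upper end
   s + 2h. *)
exists (consr (s + 2 * h) (grow z)), ((t - (s + 2 * h)) / a).
rewrite !shiftE divfK ?subrKC//; split => //.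
  by rewrite ha mulrN addrNK.
rewrite ler_ndivlMr// ler_ndivrMr//; have -> : a = - h by rewrite ha opprK.
apply/andP; split; lra.
Qed.

End banaszczyk_step.

(** * Banaszczyk's theorem by induction on the number of vectors *)

Section banaszczyk.
Context {R : realType}.

(** The construction of K*u is compatible with injective linear maps, so K can be replaced by its
    image under an isometry that takes u to the first axis. The case u = 0, where the unit of chord
    length degenerates, is settled apart and covers dimension 0. *)
Lemma gmeas_bstar n (K : set 'rV[R]_n) (u : 'rV[R]_n) : compact K -> convex_rV K ->
  \sum_i u 0 i ^+ 2 <= 5^-1 ^+ 2 -> 2^-1 <= gmeas K -> gmeas K <= gmeas (bstar K u).
Proof.
move=> cK convK u5 Khalf; have [u0|u0] := eqVneq u 0.
  apply: le_gmeas; [exact: compact_gmeasurable|apply: compact_gmeasurable; exact: bstar_compact|].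
  move=> z Kz; exists z, 0; rewrite u0 !scaler0 !addr0; split => //; apply/andP; split; lra.
case: n K u cK convK u5 Khalf u0 => [|n] K u cK convK u5 Khalf u0.
  by move: u0; rewrite [u]thinmx0 eqxx.
have [rho [a [iso rhou a2]]] := gauss_isometry_align u.
have [lin cont inj _] := iso.
have rho0 : rho 0 = 0 by have := lin (-1) 0 0; rewrite scaler0 addr0 scaleN1r addNr.
have rhoZD c x y : rho (x + c *: y) = rho x + c *: rho y.
  by rewrite addrC lin addrC.
have a0 : a != 0.
  apply: contra_neq u0 => a0; apply: inj; rewrite rhou rho0 a0.
  by apply/rowP => i; rewrite !mxE; case: unliftP => //= *; rewrite mxE.
have a5 : `|a| <= 5^-1 by rewrite -(@ler_pXn2r _ 2) ?nnegrE ?invr_ge0// real_normK ?num_real// a2.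
have cK' := continuous_compact_image cont cK.
have convK' : convex_rV (rho @` K).
  move=> _ _ t [x Kx <-] [y Ky <-] t0 t1; exists (t *: x + (1 - t) *: y); first exact: convK.
  by rewrite rhoZD -{1}[t *: x]add0r rhoZD rho0 add0r.
rewrite -(gauss_isometry_image iso cK) in Khalf *.
apply: (le_trans (gmeas_bstar_axis cK' convK' a0 a5 Khalf)).
have cB := bstar_compact (u := u) cK.
rewrite -(gauss_isometry_image iso cB).
apply: le_gmeas.
- apply: compact_gmeasurable; exact: bstar_compact.
- apply: compact_gmeasurable; exact: continuous_compact_image cont cB.
move=> z [w [t [[w0 Kw0 <-] [w1 Kw1 e] t13 ->]]].
exists (w0 + t *: u); last by rewrite rhoZD rhou.
exists w0, t; split => //; suff -> : w0 + 2 *: u = w1 by [].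
by apply: inj; rewrite rhoZD rhou e.
Qed.

Lemma gmeas_disjoint_le1 n (A B : set 'rV[R]_n) : gmeasurable A -> gmeasurable B ->
  A `&` B `<=` set0 -> gmeas A + gmeas B <= 1.
Proof.
move=> mA mB AB.
have i01 (C : set 'rV[R]_n) : gmeasurable C ->
    (gprob n).-integrable setT (EFin \o (fun z : gspace n => (\1_C (grow z) : R))).
  move=> mC; apply: integrable01; first exact: measurable_indic_grow.
  by move=> z; exact: indic01.
rewrite /gmeas -RintegralD//; try exact: i01.
rewrite -[leRHS](Rintegral_probability_cst (gprob n)); apply: le_Rintegral => //.
- exact: (integrableD measurableT (i01 _ mA) (i01 _ mB)).
- exact: finite_measure_integrable_cst.
move=> z _; rewrite !indicE; case: (boolP (_ \in A)) => Az; case: (boolP (_ \in B)) => Bz;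
  rewrite ?addr0 ?add0r ?lexx//.
by case: (AB (grow z)); split; exact: set_mem.
Qed.

Lemma half_gmeas_mem0 n (K : set 'rV[R]_n) : compact K -> convex_rV K -> 2^-1 < gmeas K -> K 0.
Proof.
move=> cK convK Khalf; apply: contrapT => K0.
have clK := compact_closed_rV cK.
have mK : gmeasurable [set v | K (- v)].
  apply: measurable_closed_grow; apply: (closed_continuous_preimage _ clK) => x.
  exact: cvgN cvg_id.
have := gmeas_disjoint_le1 (compact_gmeasurable cK) mK; rewrite gmeasN//.
have KN : K `&` [set v | K (- v)] `<=` set0.
  move=> x [Kx /= Kx']; apply: K0; have := convK _ _ 2^-1 Kx Kx'.
  rewrite (_ : 1 - 2^-1 = 2^-1 :> R); last by field.
  by rewrite scalerN subrr; apply; lra.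
by move=> /(_ KN); lra.
Qed.

Theorem banaszczyk5 n m (u : 'I_m -> 'rV[R]_n) (K : set 'rV[R]_n) : compact K -> convex_rV K ->
  (forall i, \sum_k u i 0 k ^+ 2 <= 5^-1 ^+ 2) -> 2^-1 < gmeas K ->
  exists sigma : 'I_m -> R, (forall i, sigma i = 1 \/ sigma i = -1) /\
    K (\sum_i sigma i *: u i).
Proof.
elim: m u K => [|m IH] u K cK convK u5 Khalf.
  exists (fun=> 1); split; first by case.
  by rewrite big_ord0; exact: half_gmeas_mem0.
have KB := gmeas_bstar cK convK (u5 ord0) (ltW Khalf).
have [sigma [s1 Bs]] := IH (u \o lift ord0) (bstar K (u ord0)) (bstar_compact cK)
  (bstar_convex convK) (fun i => u5 _) (lt_le_trans Khalf KB).
have extend e : e = 1 \/ e = -1 -> K (e *: u ord0 + \sum_i sigma i *: u (lift ord0 i)) ->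
    exists sigma : 'I_m.+1 -> R, (forall i, sigma i = 1 \/ sigma i = -1) /\
      K (\sum_i sigma i *: u i).
  move=> e1 Ke; exists (fun i => oapp sigma e (unlift ord0 i)); split.
    by move=> i; case: unliftP => [j|] _ /=.
  rewrite big_ord_recl unlift_none; under eq_bigr do rewrite liftK.
  exact: Ke.
case: (bstar_sub convK Bs) => Kz.
  by apply: (extend (-1)); [right|rewrite scaleN1r addrC].
by apply: (extend 1); [left|rewrite scale1r addrC].
Qed.

End banaszczyk.

(** * Products of bodies and concatenation of vectors *)

Section product_bodies.
Context {R : realType}.
Local Notation N := (@normal_prob R 0 1).

Definition row_prod a b (A : set 'rV[R]_a) (B : set 'rV[R]_b) : set 'rV[R]_(a + b) :=
  [set v | A (lsubmx v) /\ B (rsubmx v)].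

Lemma row_prod_compact a b (A : set 'rV[R]_a) (B : set 'rV[R]_b) :
  compact A -> compact B -> compact (row_prod A B).
Proof.
move=> cA cB.
rewrite (_ : row_prod A B = (fun p : 'rV[R]_a * 'rV[R]_b => row_mx p.1 p.2) @` (A `*` B)).
  apply: continuous_compact_image; last exact: compact_setX.
  apply: continuous_rV => i.
  rewrite (_ : (fun p => _) = (fun p : 'rV[R]_a * 'rV[R]_b =>
    match fintype.split i with inl j => p.1 0 j | inr j => p.2 0 j end)); last first.
    by apply/funext => p; rewrite mxE.
  have c1 : continuous (@fst 'rV[R]_a 'rV[R]_b) by move=> y; exact: cvg_fst.
  have c2 : continuous (@snd 'rV[R]_a 'rV[R]_b) by move=> y; exact: cvg_snd.
  case: (fintype.split i) => j x.
    exact: (@continuous_comp _ _ _ fst (fun v : 'rV[R]_a => v 0 j) x (c1 x)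
      (@coord_continuous R 1 a 0 j _)).
  exact: (@continuous_comp _ _ _ snd (fun v : 'rV[R]_b => v 0 j) x (c2 x)
    (@coord_continuous R 1 b 0 j _)).
apply/seteqP; split => v; first by move=> [Av Bv]; exists (lsubmx v, rsubmx v) => //=; rewrite hsubmxK.
by move=> [[u w] [/= Au Bw] <-]; split; rewrite ?row_mxKl ?row_mxKr.
Qed.

Lemma gmeas_dim0 (A : set 'rV[R]_0) : gmeas A = \1_A 0.
Proof.
rewrite /gmeas (_ : (fun z => _) = (fun=> \1_A 0)); last first.
  by apply/funext => z; rewrite [grow z]thinmx0.
exact: Rintegral_probability_cst.
Qed.

Lemma lsubmx_consr a b t (v : 'rV[R]_(a + b)) :
  lsubmx (consr t v : 'rV[R]_(a.+1 + b)) = consr t (lsubmx v).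
Proof.
apply/rowP => i; rewrite [RHS]mxE mxE mxE; case: (unliftP ord0 i) => [j ->|->] /=.
  rewrite (_ : lshift b (lift ord0 j) = lift ord0 (lshift b j)) ?liftK/= ?mxE//.
  exact: val_inj.
by rewrite (_ : lshift b ord0 = ord0) ?unlift_none//; exact: val_inj.
Qed.

Lemma rsubmx_consr a b t (v : 'rV[R]_(a + b)) :
  rsubmx (consr t v : 'rV[R]_(a.+1 + b)) = rsubmx v.
Proof.
apply/rowP => i; rewrite !mxE (_ : rshift a.+1 i = lift ord0 (rshift a i)) ?liftK//=.
exact: val_inj.
Qed.

Lemma continuous_lsubmx a b : continuous (@lsubmx R 1 a b).
Proof.
apply: continuous_rV => i; rewrite (_ : (fun p => _) = (fun v : 'rV[R]_(a + b) => v 0 (lshift b i))).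
  exact: (@coord_continuous R 1 (a + b) 0 (lshift b i)).
by apply/funext => v; rewrite mxE.
Qed.

Lemma continuous_rsubmx a b : continuous (@rsubmx R 1 a b).
Proof.
apply: continuous_rV => i; rewrite (_ : (fun p => _) = (fun v : 'rV[R]_(a + b) => v 0 (rshift a i))).
  exact: (@coord_continuous R 1 (a + b) 0 (rshift a i)).
by apply/funext => v; rewrite mxE.
Qed.

Lemma row_prod_closed a b (A : set 'rV[R]_a) (B : set 'rV[R]_b) :
  closed A -> closed B -> closed (row_prod A B).
Proof.
move=> cA cB; apply: closedI.
  exact: (closed_continuous_preimage (@continuous_lsubmx a b)).
exact: (closed_continuous_preimage (@continuous_rsubmx a b)).
Qed.

(** Induction on the first factor by slicing, for which it matters that [a.+1 + b] computes to
    [(a + b).+1]; in dimension 0 the law is a point mass. *)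
Lemma gmeas_row_prod a b (A : set 'rV[R]_a) (B : set 'rV[R]_b) :
  closed A -> closed B -> gmeas (row_prod A B) = gmeas A * gmeas B.
Proof.
move=> cA cB; elim: a A cA => [|a IH] A cA.
  rewrite gmeas_dim0 indicE; have rE (v : 'rV[R]_(0 + b)) : rsubmx v = v.
    by apply/rowP => i; rewrite mxE; congr (v 0 _); exact: val_inj.
  case: (boolP (0 \in A)) => [/set_mem A0|A0].
    rewrite mul1r; congr (gmeas (n := b) _); apply/seteqP; split => v.
      by move=> [_]; rewrite rE.
    by move=> Bv; split; [rewrite [lsubmx _]thinmx0|rewrite (rE v)].
  rewrite mul0r -[RHS](Rintegral_probability_cst (gprob b)).
  apply: eq_Rintegral => z _; rewrite indicE memNset// => -[+ _].
  by rewrite [lsubmx _]thinmx0 => A0'; move: A0; rewrite mem_set.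
have slA t : closed [set v | A (consr t v)].
  apply: (closed_continuous_preimage _ cA).
  by apply: continuous_consr; [exact: cst_continuous|move=> x; exact: cvg_id].
have mA := measurable_closed_grow cA.
rewrite (gmeas_slice (n := (a + b)%N)); last exact: measurable_closed_grow (row_prod_closed cA cB).
rewrite (gmeas_slice mA) -RintegralZr//.
  apply: eq_Rintegral => t _; rewrite -IH//; congr gmeas.
  by apply/seteqP; split => v; rewrite /row_prod /= lsubmx_consr rsubmx_consr.
apply: integrable01.
  have := measurable_Rintegral_xsection (gprob a) (measurable_indic_grow mA)
    (fun=> indic01 A _).
  congr measurable_fun; apply/funext => t; apply: eq_Rintegral => z _ /=.
  by rewrite grow_cons !indicE; congr (_%:R); apply/idP/idP; rewrite !inE.
by move=> t; apply: gmeas01; exact: measurable_closed_grow.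
Qed.

(** The dimensions depend on j, and the existential form avoids casts along an explicit total
    dimension: the product body and the concatenation [emb] are known only through the properties
    that the reduction uses. *)
Lemma product_body s (D : 'I_s -> nat) (K : forall j, set 'rV[R]_(D j)) :
  (forall j, compact (K j)) -> (forall j, convex_rV (K j)) ->
  exists n (P : set 'rV[R]_n) (emb : (forall j, 'rV[R]_(D j)) -> 'rV[R]_n),
  [/\ compact P /\ convex_rV P, 1 - \sum_j (1 - gmeas (K j)) <= gmeas P,
    forall v, P (emb v) <-> forall j, K j (v j),
    forall v, \sum_k emb v 0 k ^+ 2 = \sum_j \sum_k v j 0 k ^+ 2 &
    forall m (c : 'I_m -> R) (x : forall j, 'I_m -> 'rV[R]_(D j)),
      emb (fun j => \sum_i c i *: x j i) = \sum_i c i *: emb (x^~ i)].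
Proof.
elim: s D K => [|s IH] D K cK convK.
  exists 0%N, [set 0], (fun=> 0); split.
  - by split; [exact: compact_set1|move=> x y t _ _ _ _ /=; exact: thinmx0].
  - by rewrite big_ord0 subr0 gmeas_dim0 indicE mem_set.
  - by move=> v; split => // _ [].
  - by move=> v; rewrite !big_ord0.
  - by move=> m c x; exact/esym/thinmx0.
have [n [P [emb [[cP convP] gP PE nE linE]]]] := IH (D \o lift ord0) (fun j => K (lift ord0 j))
  (fun j => cK _) (fun j => convK _).
exists (D ord0 + n)%N, (row_prod (K ord0) P),
  (fun v => row_mx (v ord0) (emb (fun j => v (lift ord0 j)))); split.
- split; first exact: row_prod_compact.
  move=> x y t [x1 x2] [y1 y2] t0 t1; split; rewrite linearP linearZ; [exact: convK|exact: convP].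
- rewrite gmeas_row_prod; try exact: compact_closed_rV.
  have /andP[k0 k1] := gmeas01 (compact_gmeasurable (cK ord0)).
  have /andP[p0 p1] := gmeas01 (compact_gmeasurable cP).
  (* For k and p in [0, 1] the product kp is at least 1 - (1 - k) - (1 - p), because (1 - k)(1 - p)
     >= 0. *)
  by rewrite big_ord_recl /=; nra.
- move=> v; rewrite /row_prod /= row_mxKl row_mxKr PE; split => [[v0 vS] j|vK].
    by case: (unliftP ord0 j) => [i|] ->.
  by split.
- move=> v; rewrite big_split_ord big_ord_recl -nE /=; congr (_ + _).
    by apply: eq_bigr => k _; rewrite row_mxEl.
  by apply: eq_bigr => k _; rewrite row_mxEr.
- move=> m c x; rewrite (linE m c (fun j => x (lift ord0 j))).
  apply/rowP => k; rewrite summxE mxE; case: (fintype.splitP k) => j e.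
    rewrite (_ : k = lshift n j); last exact: val_inj.
    by rewrite summxE; apply: eq_bigr => i _; rewrite !mxE (unsplitK (inl j)).
  rewrite (_ : k = rshift _ j); last exact: val_inj.
  by rewrite summxE; apply: eq_bigr => i _; rewrite !mxE (unsplitK (inr j)).
Qed.

End product_bodies.

Theorem theorem9 (R : realType) (s n : nat) (D : 'I_s -> nat)
  (x : forall j : 'I_s, 'I_n -> 'rV[R]_(D j))
  (K : forall j : 'I_s, set 'rV[R]_(D j))
  (delta : 'I_s -> R) :
  (1 <= s)%N ->
  (forall j i, l2norm (x j i) <= 1) ->
  (forall j, convex_body (K j)) ->
  (forall j, ((1 - delta j)%:E <= gauss_measure (K j))%E) ->
  \sum_(j < s) delta j < 2^-1 ->
  exists sigma : 'I_n -> R,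
    (forall i, sigma i = 1 \/ sigma i = -1) /\
    forall j : 'I_s,
      dilate (5 * Num.sqrt (s%:R)) (K j) (\sum_(i < n) sigma i *: x j i).
Proof.
move=> s1 x1 body Kdelta delta_half.
have cK j : compact (K j) by case: (body j) => _ [].
have convK j : convex_rV (K j) by case: (body j).
have [m [P [emb [[cP convP] gP PE nE linE]]]] := product_body cK convK.
have P_half : 2^-1 < gmeas P.
  apply: lt_le_trans gP.
  have : \sum_j (1 - gmeas (K j)) <= \sum_(j < s) delta j.
    apply: ler_sum => j _; have := Kdelta j.
    by rewrite gauss_measureE ?lee_fin; [lra|exact: compact_gmeasurable].
  lra.
pose c : R := (5 * Num.sqrt s%:R)^-1.
have s_gt0 : 0 < s%:R :> R by rewrite ltr0n.
have sqrt_gt0 : 0 < Num.sqrt s%:R :> R by rewrite sqrtr_gt0.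
have c0 : 5 * Num.sqrt s%:R != 0 :> R by rewrite mulf_neq0 ?gt_eqF.
have emb5 i : \sum_k emb (fun j => c *: x j i) 0 k ^+ 2 <= 5^-1 ^+ 2.
  rewrite nE.
  have -> : \sum_j \sum_k (c *: x j i) 0 k ^+ 2 = c ^+ 2 * \sum_j \sum_k x j i 0 k ^+ 2.
    rewrite mulr_sumr; apply: eq_bigr => j _; rewrite mulr_sumr.
    by apply: eq_bigr => k _; rewrite mxE exprMn.
  have xs : \sum_j \sum_k x j i 0 k ^+ 2 <= s%:R.
    rewrite -[s%:R](_ : \sum_(j < s) 1 = _); last by rewrite sumr_const card_ord.
    apply: ler_sum => j _; have := x1 j i; rewrite /l2norm => xj.
    by rewrite -sqrtr1 ler_sqrt// in xj.
  have -> : c ^+ 2 = 5^-1 ^+ 2 / s%:R.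
    by rewrite /c invfM exprMn [X in _ * X]exprVn sqr_sqrtr// ltW.
  by rewrite -mulrA ler_piMr// ?sqr_ge0// mulrC ler_pdivrMr// mul1r.
have [sigma [sigma1 Psigma]] := banaszczyk5 cP convP emb5 P_half.
exists sigma; split => // j.
move: Psigma; rewrite -(linE _ sigma (fun j i => c *: x j i)) PE => /(_ j) Kj.
exists (\sum_i sigma i *: (c *: x j i)) => //.
rewrite scaler_sumr; apply: eq_bigr => i _.
by rewrite !scalerA mulrAC divff// mul1r.
Qed.
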